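(* Let $\sigma>0$. For every $\varepsilon\in(0,1)$ there exist constants $c,C>0$, depending only on $\sigma$ and $\varepsilon$, such that the following holds for all integers $n\ge 2$ and $d\ge 1$. (i) (Upper bound) If $\log d\le n^{1-\varepsilon}$, there exists an estimator $\hat f_n$ (depending on the sample $\mathcal D_n$ but not on $K$) such that for every real $K$ with $1\le K\le d$, $$\sup_{f\in\mathcal F_K} R(\hat f_n,f)\;\le\; C\,\frac{K}{\sqrt{\log n}},$$ for every admissible noise distribution. (ii) (Lower bound) For every real $K$ with $0<K\le c\sqrt{\log n}$, if $d\ge (1/c)\log n$, then $$\inf_{\tilde f}\ \sup_{f\in\mathcal F_K} R(\tilde f,f)\;\ge\; c\,\frac{K^2}{(\log n)^{3/2}},$$ where the infimum is over all estimators $\tilde f=\tilde f(\mathcal D_n)$ and the supremum is understood in the worst case over admissible noise distributions as well as over $f\in\mathcal F_K$.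
   Context: Model. $\{0,1\}^d$ carries the coordinatewise partial order and the uniform probability measure $\mu$. One observes $\mathcal D_n=\{(X_1,Y_1),\dots,(X_n,Y_n)\}$ with $Y_j=f(X_j)+\varepsilon_j$, where $X_1,\dots,X_n$ are i.i.d. with law $\mu$, and $\varepsilon_1,\dots,\varepsilon_n$ are independent centered real random variables, independent of the $X_j$, with $\mathbb E[e^{t\varepsilon_j}]\le e^{\sigma^2t^2/2}$ for all $t\in\mathbb R$. Any joint law of $(\varepsilon_1,\dots,\varepsilon_n)$ with these properties is called an admissible noise distribution (for the parameter $\sigma$). An estimator is a (measurable) map assigning to the sample $\mathcal D_n$ a function $\{0,1\}^d\to\mathbb R$; it may not depend on the unknown $f$ or on the noise distribution. Risk. $R(\hat f,f)=\mathbb E_{\mathcal D_n}[\|\hat f-f\|_2^2]$, where $\|g\|_2^2=2^{-d}\sum_{x\in\{0,1\}^d}g(x)^2$ and the expectation is over the sample generated from $f$ and the noise distribution. Influence. For $x\in\{0,1\}^d$, $i\in[d]=\{1,\dots,d\}$, $b\in\{0,1\}$, let $x^{i\to b}$ be $x$ with $i$-th coordinate replaced by $b$, and $\Delta_i f(x)=f(x^{i\to1})-f(x^{i\to0})$. The $L^1$-influence is $I_i(f)=\mathbb E_{X\sim\mu}[|\Delta_i f(X)|]$ and the total $L^1$-influence is $I(f)=\sum_{i=1}^d I_i(f)$. Class. $f$ is monotone if $x\le y$ coordinatewise implies $f(x)\le f(y)$. For $K>0$, $\mathcal F_K=\{f:\{0,1\}^d\to[0,1]\ :\ f\text{ monotone},\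 I(f)\le K\}$. *)

(* Defs.v *)
From HB Require Import structures.
From mathcomp Require Import all_boot all_order all_algebra.
From mathcomp Require Import all_classical all_reals all_analysis.

Set Implicit Arguments.
Unset Strict Implicit.
Unset Printing Implicit Defensive.

Import Order.TTheory GRing.Theory Num.Theory.
Import numFieldNormedType.Exports.

Local Open Scope classical_set_scope.
Local Open Scope ring_scope.

(* The product sigma-algebra that n.-tuple inherits from bool is the full
   power set here, so that measurability over [cube d] carries no content. *)
Notation cube d := (d.-tuple bool).

Section Functions.
Context {R : realType} {d : nat}.
Implicit Types (f g : cube d -> R) (x y : cube d) (i : 'I_d).

(* Expectation under the uniform measure on the cube. *)
Definition cube_mean g : R := (2 ^+ d)^-1 * \sum_(x : cube d) g x.

Definition sqnorm2 g : R := cube_mean (fun x => g x ^+ 2).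

Definition set_coord x i (b : bool) : cube d :=
  [tuple if j == i then b else tnth x j | j < d].

Definition discrete_derivative f i x : R :=
  f (set_coord x i true) - f (set_coord x i false).

Definition influence f i : R :=
  cube_mean (fun x => `|discrete_derivative f i x|).

Definition total_influence f : R := \sum_(i < d) influence f i.

Definition cube_monotone f :=
  forall x y, (forall i, (tnth x i <= tnth y i)%O) -> f x <= f y.

Definition monotone_class (K : R) : set (cube d -> R) :=
  [set f | [/\ forall x, 0 <= f x <= 1, cube_monotone f
             & total_influence f <= K]].

End Functions.

Section Sampling.
Context {R : realType}.

(* The factors A i may be the full space, so this is mutual independence of
   every subfamily of the coordinates. *)
Definition independent_coords {dT} {T : measurableType dT} {n : nat}
    (Q : probability (n.-tuple T) R) :=
  forall A : 'I_n -> set T, (forall i, measurable (A i)) ->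
    Q [set t | forall i, A i (tnth t i)] =
    (\prod_(i < n) Q [set t | A i (tnth t i)])%E.

Definition iid_uniform {d n : nat} (Q : probability (n.-tuple (cube d)) R) :=
  independent_coords Q /\
  forall (i : 'I_n) (x : cube d),
    Q [set t | tnth t i = x] = ((2 ^+ d)^-1)%:E.

Definition admissible_noise {n : nat} (sigma : R)
    (Q : probability (n.-tuple R) R) :=
  [/\ independent_coords Q,
      forall i : 'I_n, ('E_Q[fun e => tnth e i] = 0)%E
    & forall (i : 'I_n) (t : R),
        ('E_Q[fun e => expR (t * tnth e i)%R]
          <= (expR (sigma ^+ 2 * t ^+ 2 / 2)%R)%:E)%E].

Definition independent_RV {dO d1 d2} {Om : measurableType dO}
    {T1 : measurableType d1} {T2 : measurableType d2}
    (P : probability Om R) (X : {RV P >-> T1}) (Y : {RV P >-> T2}) :=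
  forall (A : set T1) (B : set T2), measurable A -> measurable B ->
    P (X @^-1` A `&` Y @^-1` B) = (P (X @^-1` A) * P (Y @^-1` B))%E.

Definition sampling_model {dO} {Om : measurableType dO} {d n : nat}
    (sigma : R) (P : probability Om R)
    (X : {RV P >-> n.-tuple (cube d)}) (e : {RV P >-> n.-tuple R}) :=
  [/\ iid_uniform (distribution P X),
      admissible_noise sigma (distribution P e)
    & independent_RV X e].

Definition sample {d n : nat} (f : cube d -> R)
    (x : n.-tuple (cube d)) (e : n.-tuple R) : n.-tuple (cube d * R) :=
  [tuple (tnth x j, f (tnth x j) + tnth e j) | j < n].

(* Being a map into a finite-dimensional space, an estimator is measurable
   exactly when all its coordinates are. *)
Definition estimator (d n : nat) :
    set (n.-tuple (cube d * R) -> cube d -> R) :=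
  [set fhat | forall x, measurable_fun [set: n.-tuple (cube d * R)]
                          (fun s => fhat s x)].

Definition risk {dO} {Om : measurableType dO} {d n : nat}
    (P : probability Om R)
    (X : {RV P >-> n.-tuple (cube d)}) (e : {RV P >-> n.-tuple R})
    (fhat : n.-tuple (cube d * R) -> cube d -> R) (f : cube d -> R) : \bar R :=
  ('E_P[fun w => sqnorm2 (fun x => fhat (sample f (X w) (e w)) x - f x)%R])%E.

Definition worst_case_risk {d n : nat} (sigma K : R)
    (fhat : n.-tuple (cube d * R) -> cube d -> R) : \bar R :=
  ereal_sup [set r | exists (dO : measure_display) (Om : measurableType dO)
      (P : probability Om R) (X : {RV P >-> n.-tuple (cube d)})
      (e : {RV P >-> n.-tuple R}) (f : cube d -> R),
    [/\ sampling_model sigma X e, monotone_class K f & r = risk X e fhat f]].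

End Sampling.
Arguments estimator R d n : clear implicits.

(* Main.v *)
From HB Require Import structures.
Require Import Defs.
From mathcomp Require Import all_boot all_order all_algebra.
From mathcomp Require Import all_classical all_reals all_analysis.
From mathcomp Require Import measurable_realfun zify ring lra.
Import Order.TTheory GRing.Theory Num.Theory.
Import numFieldNormedType.Exports.
Local Open Scope classical_set_scope.
Local Open Scope ring_scope.

Set Implicit Arguments.
Unset Strict Implicit.
Unset Printing Implicit Defensive.

(* Upper bound.  Write [f] in the Walsh basis.  Since [|D_i f| <= 1/2], the
   L1-influence dominates the spectral energy [sum_S |S| fcoef f S ^ 2], so the
   weight above degree [m] is at most [K / m].  Hypercontractivity shows that the
   low-degree weight touching variables of influence below [36^-m] is also
   [O(K / m)].  By monotonicity [fcoef f {i}] is half the influence of [i], so the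
   influential variables can be read off from empirical degree-one coefficients;
   what remains are [(K 36^m)^m] coefficients, which for [m ~ sqrt (ln n)] is a
   small power of [n].  Every stochastic estimate follows from one bound on the
   moment generating function of an empirical coefficient.

   Lower bound.  Even without noise, a function of [m ~ ln n] variables that is
   [0] below the middle layer, [a] above it and arbitrary in [{0, a}] on it cannot
   be learned on the middle layer, most of which is not observed.  That layer has
   mass of order [1 / sqrt m], and a monotone function of [m] variables with values
   in [[0, a]] has total influence at most [2 a sqrt m], which gives the choice
   [a ~ K / sqrt (ln n)]. *)

(** * Fourier analysis on the cube *)

(** One sample serves both to select variables and to estimate coefficients, so the range of
    summation of the estimator is random. On the event that all degree-one coefficients are
    accurate, that range lies in a deterministic family built from the truly influential variables;
    off that event, clipping keeps the loss at most [1]. Both cases are merged into one pointwise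
    bound of the loss by exponentials, so that taking expectations only uses linearity and the
    moment generating function.

    Uniform accuracy is required of the [d] degree-one coefficients only, at a precision that decays
    more slowly than any power of [n]. The union bound then pays a factor [d] against an exponential
    in [n ^ (1 - o(1))], and this is where [ln d <= n ^ (1 - eps)] enters.

    The degree and the threshold depend on [n] alone, which gives adaptivity to [K]: for [K] above
    [sqrt (ln n)] the claim is trivial, and below it the number of coefficients to estimate is at
    most a constant times [n ^ (1/4)] once [n] is large. *)

Lemma sum_tuple_prod (R : comNzRingType) (T : finType) n (F : 'I_n -> T -> R) :
  \sum_(t : n.-tuple T) \prod_(i < n) F i (tnth t i) =
  \prod_(i < n) \sum_(x : T) F i x.
Proof.
rewrite (bigA_distr_bigA F) (reindex (@tuple_of_finfun T n)); last first.
  by apply: onW_bij; exists finfun_of_tuple;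
    [exact: tuple_of_finfunK | exact: finfun_of_tupleK].
apply: eq_bigr => f _; apply: eq_bigr => i _.
by rewrite tnth_map tnth_ord_tuple.
Qed.

Section CubeMean.
Context {R : realType} {d : nat}.
Implicit Types (f g h u v : cube d -> R) (x y : cube d) (i : 'I_d).

Lemma card_cube : #|{: cube d}|%:R = 2 ^+ d :> R.
Proof. by rewrite card_tuple card_bool natrX. Qed.

Lemma eq_cube_mean f g : f =1 g -> cube_mean f = cube_mean g.
Proof. by move=> fg; rewrite /cube_mean; congr (_ * _); apply: eq_bigr. Qed.

Lemma cube_mean_cst (c : R) : cube_mean (fun _ : cube d => c) = c.
Proof.
by rewrite /cube_mean sumr_const -(mulr_natl c) [X in X * c]card_cube mulKf //.
Qed.

Lemma cube_meanD f g :
  cube_mean (fun x => f x + g x) = cube_mean f + cube_mean g.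
Proof. by rewrite /cube_mean big_split mulrDr. Qed.

Lemma cube_meanZ (c : R) f : cube_mean (fun x => c * f x) = c * cube_mean f.
Proof. by rewrite /cube_mean -mulr_sumr mulrCA. Qed.

Lemma cube_meanB f g :
  cube_mean (fun x => f x - g x) = cube_mean f - cube_mean g.
Proof. by rewrite /cube_mean sumrB mulrBr. Qed.

Lemma cube_mean_sum (I : Type) (r : seq I) (P : pred I) (F : I -> cube d -> R) :
  cube_mean (fun x => \sum_(k <- r | P k) F k x) =
  \sum_(k <- r | P k) cube_mean (F k).
Proof. by rewrite /cube_mean exchange_big -mulr_sumr. Qed.

Lemma ler_cube_mean f g :
  (forall x, f x <= g x) -> cube_mean f <= cube_mean g.
Proof.
move=> fg; rewrite /cube_mean ler_wpM2l ?invr_ge0 ?exprn_ge0 //.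
exact: ler_sum.
Qed.

Lemma cube_mean_ge0 f : (forall x, 0 <= f x) -> 0 <= cube_mean f.
Proof.
by move=> f0; rewrite -[leLHS](cube_mean_cst 0); exact: ler_cube_mean.
Qed.

Lemma cube_mean_prod (F : 'I_d -> bool -> R) :
  cube_mean (fun x => \prod_i F i (tnth x i)) =
  \prod_i ((F i true + F i false) / 2).
Proof.
rewrite /cube_mean sum_tuple_prod big_split /= prodr_const card_ord exprVn mulrC.
by congr (_ * _); apply: eq_bigr => i _; rewrite big_bool.
Qed.

Lemma cube_mean_CS u v :
  cube_mean (fun x => u x * v x) ^+ 2 <=
  cube_mean (fun x => u x ^+ 2) * cube_mean (fun x => v x ^+ 2).
Proof.
pose A := cube_mean (fun x => u x ^+ 2); pose B := cube_mean (fun x => v x ^+ 2).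
pose C := cube_mean (fun x => u x * v x).
have key (s t : R) : 0 <= s ^+ 2 * A + 2 * s * t * C + t ^+ 2 * B.
  rewrite -!cube_meanZ -!cube_meanD; apply: cube_mean_ge0 => x.
  have -> : s ^+ 2 * u x ^+ 2 + 2 * s * t * (u x * v x) + t ^+ 2 * v x ^+ 2 =
    (s * u x + t * v x) ^+ 2 by ring.
  exact: sqr_ge0.
have A0 : 0 <= A by apply: cube_mean_ge0 => x; exact: sqr_ge0.
have B0 : 0 <= B by apply: cube_mean_ge0 => x; exact: sqr_ge0.
rewrite -/A -/B -/C.
have [Ap|A0'] := boolP (0 < A); last first.
  (* In the degenerate case the form at [(B + 1, - C)] equals [- C ^ 2 * (B + 2)], which forces
     [C = 0]. Otherwise [(- C, A)] gives [A] times the desired difference. *)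
  have {}A0' : A = 0 by apply/eqP; rewrite eq_le A0 andbT leNgt.
  have := key (B + 1) (- C); rewrite A0' mulr0 mul0r.
  rewrite add0r => h.
  have e : 2 * (B + 1) * - C * C + (- C) ^+ 2 * B = - (C ^+ 2 * (B + 2)) by ring.
  by move: h; rewrite e oppr_ge0 pmulr_lle0 // ltr_wpDl.
have := key (- C) A.
have -> : (- C) ^+ 2 * A + 2 * - C * A * C + A ^+ 2 * B = A * (A * B - C ^+ 2) by ring.
by rewrite pmulr_rge0 // subr_ge0.
Qed.

Definition flip i x : cube d := set_coord x i (~~ tnth x i).

Lemma tnth_set_coord x i b j :
  tnth (set_coord x i b) j = if j == i then b else tnth x j.
Proof. by rewrite tnth_mktuple. Qed.

Lemma flipK i : involutive (flip i).
Proof.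
move=> x; apply: eq_from_tnth => j; rewrite !tnth_set_coord eqxx.
by case: eqP => // ->; rewrite negbK.
Qed.

Lemma set_coord_tnth x i : set_coord x i (tnth x i) = x.
Proof. by apply: eq_from_tnth => j; rewrite tnth_set_coord; case: eqP => // ->. Qed.

Lemma cube_mean_set_coord i g :
  cube_mean g =
  cube_mean (fun x => (g (set_coord x i true) + g (set_coord x i false)) / 2).
Proof.
have E : cube_mean g = cube_mean (fun x => g (flip i x)).
  rewrite /cube_mean; congr (_ * _); rewrite (reindex_inj (inv_inj (flipK i))) //.
suff -> : cube_mean (fun x => (g (set_coord x i true) + g (set_coord x i false)) / 2)
    = 2^-1 * (cube_mean g + cube_mean (fun x => g (flip i x))).
  by rewrite -E; field.
rewrite -cube_meanD -cube_meanZ; apply: eq_cube_mean => x.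
rewrite mulrC; congr (_ * _); rewrite /flip.
by move: (set_coord_tnth x i); case: (tnth x i) => /= ->; rewrite // addrC.
Qed.

End CubeMean.

Section Fourier.
Context {R : realType} {d : nat}.
Implicit Types (f g h : cube d -> R) (x y : cube d) (i : 'I_d)
  (S T D : {set 'I_d}).

Definition sg (b : bool) : R := if b then 1 else -1.

Lemma sg_sq b : sg b * sg b = 1.
Proof. by case: b; rewrite /= ?mulr1 // mulrNN mulr1. Qed.

Lemma normr_sg b : `|sg b| = 1.
Proof. by case: b; rewrite /= ?normrN normr1. Qed.

Definition chi S x : R := \prod_(i in S) sg (tnth x i).

Definition fcoef f S : R := cube_mean (fun x => f x * chi S x).

Lemma chi_all S x : chi S x = \prod_i (if i \in S then sg (tnth x i) else 1).
Proof. by rewrite /chi big_mkcond. Qed.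

Lemma normr_chi S x : `|chi S x| = 1.
Proof. by rewrite /chi normr_prod big1 // => i _; rewrite normr_sg. Qed.

Lemma chi_set0 x : chi finset.set0 x = 1.
Proof. by rewrite /chi big_set0. Qed.

Lemma chi_setU1 i S x : i \notin S -> chi (i |: S)%SET x = sg (tnth x i) * chi S x.
Proof. by move=> iS; rewrite /chi big_setU1. Qed.

Lemma chi_set_coord i S x b : i \notin S -> chi S (set_coord x i b) = chi S x.
Proof.
move=> iS; apply: eq_bigr => j jS; rewrite tnth_set_coord.
by case: eqP => // ji; move: iS; rewrite -ji jS.
Qed.

Lemma sum_prod_set (z : 'I_d -> R) :
  \sum_(S : {set 'I_d}) \prod_(i in S) z i = \prod_i (1 + z i).
Proof.
under [RHS]eq_bigr do rewrite addrC.
rewrite bigA_distr; apply: eq_bigr => S _.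
by rewrite [LHS]big_mkcond.
Qed.

(** The sum over [S] factors as the product of [1 + sg x_i * sg y_i], and a coordinate where [x] and
    [y] differ kills it. This completeness relation yields inversion without a dimension count. *)
Lemma sum_chi_chi x y :
  \sum_(S : {set 'I_d}) chi S x * chi S y = 2 ^+ d * (x == y)%:R.
Proof.
under eq_bigr do rewrite /chi -big_split /=.
rewrite sum_prod_set; have [->|/eqP xy] := eqVneq x y.
  under eq_bigr do rewrite sg_sq.
  by rewrite prodr_const card_ord mulr1.
have [i xyi] : exists i, tnth x i != tnth y i.
  apply/existsP; rewrite -negb_forall; apply/negP => /forallP h.
  by apply: xy; apply: eq_from_tnth => i; apply/eqP.
rewrite mulr0 (bigD1 i) //=; move: xyi; case: (tnth x i); case: (tnth y i) => //= _.
  by rewrite mul1r subrr mul0r.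
by rewrite mulr1 subrr mul0r.
Qed.

Lemma fourier_inversion f x : f x = \sum_S fcoef f S * chi S x.
Proof.
rewrite /fcoef /cube_mean.
under eq_bigr do rewrite -mulrA mulr_suml.
rewrite -mulr_sumr exchange_big /=.
under eq_bigr => y _.
  under eq_bigr do rewrite -mulrA.
  rewrite -mulr_sumr sum_chi_chi.
  over.
rewrite (bigD1 x) //= eqxx big1 ?addr0; last first.
  by move=> y yx; rewrite (negbTE yx) !mulr0.
by rewrite mulr1 mulrCA mulVf ?mulr1 // expf_neq0.
Qed.

Lemma chi_orthonormal S T :
  cube_mean (fun x => chi S x * chi T x) = (S == T)%:R.
Proof.
under eq_cube_mean do rewrite !chi_all -big_split /=.
rewrite (cube_mean_prod (fun i b =>
  (if i \in S then sg b else 1) * (if i \in T then sg b else 1))).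
have [->|/eqP ST] := eqVneq S T.
  by rewrite big1 // => i _; case: (i \in T) => /=; field.
have [i STi] : exists i, (i \in S) != (i \in T).
  apply/existsP; rewrite -negb_forall; apply/negP => /forallP h.
  by apply: ST; apply/setP => i; apply/eqP.
rewrite (bigD1 i) //=; move: STi; case: (i \in S); case: (i \in T) => //= _;
by rewrite !(mul1r, mulr1) subrr !mul0r.
Qed.

Lemma cube_mean_mul_sum (P : pred {set 'I_d}) f (c : {set 'I_d} -> R) :
  cube_mean (fun x => (\sum_(S | P S) c S * chi S x) * f x) =
  \sum_(S | P S) c S * fcoef f S.
Proof.
under eq_cube_mean do rewrite mulr_suml.
rewrite cube_mean_sum; apply: eq_bigr => S _.
rewrite /fcoef -cube_meanZ; apply: eq_cube_mean => x; ring.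
Qed.

Lemma fcoef_sum (P : pred {set 'I_d}) (c : {set 'I_d} -> R) T :
  fcoef (fun x => \sum_(S | P S) c S * chi S x) T = if P T then c T else 0.
Proof.
rewrite /fcoef cube_mean_mul_sum.
under eq_bigr do rewrite /fcoef chi_orthonormal.
rewrite big_mkcond (bigD1 T) //= eqxx mulr1 big1 ?addr0 //.
by move=> S ST; rewrite eq_sym (negbTE ST) mulr0 if_same.
Qed.

Lemma parseval_sum (P : pred {set 'I_d}) (c : {set 'I_d} -> R) :
  cube_mean (fun x => (\sum_(S | P S) c S * chi S x) ^+ 2) =
  \sum_(S | P S) c S ^+ 2.
Proof.
under eq_cube_mean do rewrite expr2.
rewrite cube_mean_mul_sum; apply: eq_bigr => S PS.
by rewrite fcoef_sum PS expr2.
Qed.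

Lemma parseval f : sqnorm2 f = \sum_S fcoef f S ^+ 2.
Proof.
rewrite -parseval_sum; apply: eq_cube_mean => x.
by rewrite -fourier_inversion.
Qed.

(** With the halving this is the derivative in the [sg] variables: its coefficients are exactly
    those of [f] at [i |: S], and it is at most [1/2] when [f] takes values in [[0, 1]]. *)
Definition half_derivative f i x : R := discrete_derivative f i x / 2.

Lemma fcoef_half_derivative f i S : i \notin S ->
  fcoef (half_derivative f i) S = fcoef f (i |: S)%SET.
Proof.
move=> iS; rewrite /fcoef [RHS](cube_mean_set_coord i); apply: eq_cube_mean => x.
rewrite !chi_setU1 // !chi_set_coord // !tnth_set_coord eqxx.
rewrite /half_derivative /discrete_derivative /=; ring.
Qed.

(* Induction on the variables: split [h = h0 + sg x_i * h1]; the terms odd in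
   [x_i] average out, and [h1] has degree one less than [h]. *)
Lemma bonami m D (c : {set 'I_d} -> R) :
  let h x := \sum_(S : {set 'I_d} | (S \subset D) && (#|S| <= m)%N) c S * chi S x in
  cube_mean (fun x => h x ^+ 4) <= 9 ^+ m * cube_mean (fun x => h x ^+ 2) ^+ 2.
Proof.
move Ek : #|D| => k; elim: k D Ek m c => [|k IH] D Ek m c /=.
  have /eqP -> : D == finset.set0 by rewrite -cards_eq0 Ek.
  have hE x : \sum_(S : {set 'I_d} | (S \subset finset.set0) && (#|S| <= m)%N)
      c S * chi S x =
      c finset.set0.
    rewrite (big_pred1 finset.set0) ?chi_set0 ?mulr1 // => S.
    by rewrite finset.subset0 /=; have [->|] := eqVneq; rewrite ?cards0.
  under eq_cube_mean do rewrite hE.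
  under [X in _ <= _ * X ^+ 2]eq_cube_mean do rewrite hE.
  rewrite !cube_mean_cst -exprM ler_peMl ?exprn_ege1 ?ler1n //.
  by rewrite exprn_even_ge0.
have [i iD] : exists i, i \in D by apply/card_gt0P; rewrite Ek.
pose D' := (D :\ i)%SET.
have D'k : #|D'| = k by move: Ek; rewrite (cardsD1 i) iD => -[].
pose h0 x := \sum_(S : {set 'I_d} | (S \subset D') && (#|S| <= m)%N) c S * chi S x.
pose h1 x := if m is m'.+1 then
  \sum_(S : {set 'I_d} | (S \subset D') && (#|S| <= m')%N) c (i |: S)%SET * chi S x else 0.
pose h x := \sum_(S : {set 'I_d} | (S \subset D) && (#|S| <= m)%N) c S * chi S x.
have hE x : h x = h0 x + sg (tnth x i) * h1 x.
  rewrite /h (bigID (fun S : {set 'I_d} => i \notin S)) /=; congr (_ + _).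
    apply: eq_bigl => S; rewrite subsetD1.
    by case: (S \subset D); case: (i \in S) => /=; rewrite ?andbT ?andbF.
  rewrite (reindex_onto (fun S => i |: S)%SET (fun S => S :\ i)%SET) /=; last first.
    by move=> S /andP[_]; rewrite negbK => iS; rewrite finset.setD1K.
  have PE S : [&& (i |: S \subset D)%SET && (#|(i |: S)%SET| <= m)%N,
      ~~ (i \notin (i |: S)%SET) & ((i |: S) :\ i == S)%SET] =
      (S \subset D') && (#|S| < m)%N.
    rewrite subsetD1 negbK finset.setU11 /=.
    have [iS|iS] := boolP (i \in S).
      rewrite andbF /=; apply/negbTE; rewrite negb_and; apply/orP; right.
      by apply/eqP => /finset.setP/(_ i); rewrite !finset.inE eqxx iS.
    rewrite finset.setU1K // eqxx andbT cardsU1 iS finset.subUset.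
    by rewrite finset.sub1set iD !andbT.
  rewrite (eq_bigl (fun S : {set 'I_d} => (S \subset D') && (#|S| < m)%N));
    last by move=> S; rewrite -PE -?andbA.
  rewrite {PE} /h1.
  case: (m) => [|m'].
    by rewrite mulr0 big_pred0 // => S; rewrite ltn0 andbF.
  rewrite mulr_sumr; apply: eq_bigr => S; rewrite subsetD1 => /andP[/andP[_ iS] _].
  by rewrite chi_setU1 //; ring.
have h0i x b : h0 (set_coord x i b) = h0 x.
  apply: eq_bigr => S; rewrite subsetD1 => /andP[/andP[_ iS] _].
  by rewrite chi_set_coord.
have h1i x b : h1 (set_coord x i b) = h1 x.
  rewrite /h1; case: (m) => // m'.
  apply: eq_bigr => S; rewrite subsetD1 => /andP[/andP[_ iS] _].
  by rewrite chi_set_coord.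
have hb x b : h (set_coord x i b) = h0 x + sg b * h1 x.
  by rewrite hE h0i h1i tnth_set_coord eqxx.
pose M0 := cube_mean (fun x => h0 x ^+ 2); pose M1 := cube_mean (fun x => h1 x ^+ 2).
pose C := cube_mean (fun x => h0 x ^+ 2 * h1 x ^+ 2).
have E2 : cube_mean (fun x => h x ^+ 2) = M0 + M1.
  rewrite (cube_mean_set_coord i) -cube_meanD; apply: eq_cube_mean => x.
  by rewrite !hb /=; field.
have E4 : cube_mean (fun x => h x ^+ 4) =
    cube_mean (fun x => h0 x ^+ 4) + 6 * C + cube_mean (fun x => h1 x ^+ 4).
  rewrite (cube_mean_set_coord i) -cube_meanZ -!cube_meanD; apply: eq_cube_mean => x.
  by rewrite !hb /=; field.
rewrite -/h E2 E4.
have M00 : 0 <= M0 by apply: cube_mean_ge0 => x; exact: sqr_ge0.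
have M10 : 0 <= M1 by apply: cube_mean_ge0 => x; exact: sqr_ge0.
have I0 : cube_mean (fun x => h0 x ^+ 4) <= 9 ^+ m * M0 ^+ 2 by exact: (IH D' D'k m c).
have I1 : 9 * cube_mean (fun x => h1 x ^+ 4) <= 9 ^+ m * M1 ^+ 2.
  rewrite /M1 /h1; case: (m) => [|m'].
    by rewrite !expr0n /= cube_mean_cst; lra.
  rewrite exprS -mulrA ler_pM2l //.
  exact: (IH D' D'k m' (fun S => c (i |: S)%SET)).
have CC : C ^+ 2 <= cube_mean (fun x => h0 x ^+ 4) * cube_mean (fun x => h1 x ^+ 4).
  have sq (a : R) : a ^+ 4 = (a ^+ 2) ^+ 2 by rewrite -exprM.
  under eq_cube_mean do rewrite sq.
  under [X in _ <= _ * X]eq_cube_mean do rewrite sq.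
  exact: cube_mean_CS.
have q0 : 0 <= 9 ^+ m :> R by exact: exprn_ge0.
have n1 : 0 <= cube_mean (fun x => h1 x ^+ 4).
  by apply: cube_mean_ge0 => x; rewrite exprn_even_ge0.
have n0 : 0 <= cube_mean (fun x => h0 x ^+ 4).
  by apply: cube_mean_ge0 => x; rewrite exprn_even_ge0.
(* The lower degree of [h1] gains a factor [9] in its fourth moment, hence [3] after Cauchy-Schwarz.
   This turns the [6 * C] of [E4] into the cross term of [(M0 + M1) ^ 2]. *)
have C3 : 3 * C <= 9 ^+ m * (M0 * M1).
  have M010 : 0 <= 9 ^+ m * (M0 * M1) by rewrite mulr_ge0 // mulr_ge0.
  rewrite (le_trans (ler_norm _)) // -ler_sqr ?nnegrE //.
  rewrite real_normK ?num_real // exprMn.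
  have -> : (9 ^+ m * (M0 * M1)) ^+ 2 = (9 ^+ m * M0 ^+ 2) * (9 ^+ m * M1 ^+ 2) :> R by ring.
  apply: (@le_trans _ _ (cube_mean (fun x => h0 x ^+ 4) *
      (9 * cube_mean (fun x => h1 x ^+ 4)))).
    by rewrite (_ : 3 ^+ 2 = 9 :> R); [lra|ring].
  by apply: ler_pM => //; rewrite mulr_ge0.
have -> : 9 ^+ m * (M0 + M1) ^+ 2 =
    9 ^+ m * M0 ^+ 2 + 2 * (9 ^+ m * (M0 * M1)) + 9 ^+ m * M1 ^+ 2 by ring.
lra.
Qed.

End Fourier.

(** * Influences of monotone functions *)

Section Influences.
Context {R : realType} {d : nat}.
Implicit Types (f g : cube d -> R) (x : cube d) (i : 'I_d) (S J : {set 'I_d}).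

Lemma sum_set_mem i (P : pred {set 'I_d}) (F : {set 'I_d} -> R) :
  \sum_(S : {set 'I_d} | (i \in S) && P S) F S =
  \sum_(S : {set 'I_d} | (i \notin S) && P (i |: S)%SET) F (i |: S)%SET.
Proof.
rewrite (reindex_onto (fun S => i |: S)%SET (fun S => S :\ i)%SET) /=; last first.
  by move=> S /andP[iS _]; rewrite finset.setD1K.
apply: eq_bigl => S; rewrite finset.setU11 /= andbC; congr (_ && _).
have [iS|iS] := boolP (i \in S); last by rewrite finset.setU1K // eqxx.
by apply/negbTE/eqP => /finset.setP/(_ i); rewrite !finset.inE eqxx iS.
Qed.

Lemma cube_le_set_coord f i x : cube_monotone f ->
  f (set_coord x i false) <= f (set_coord x i true).
Proof.
by move=> mf; apply: mf => j; rewrite !tnth_set_coord; case: ifP.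
Qed.

Lemma half_derivative_ge0 f i x : cube_monotone f -> 0 <= half_derivative f i x.
Proof.
by move=> mf; rewrite divr_ge0 // subr_ge0 cube_le_set_coord.
Qed.

Lemma half_derivative_le f i x : (forall x, 0 <= f x <= 1) ->
  half_derivative f i x <= 2^-1.
Proof.
move=> f01; rewrite /half_derivative /discrete_derivative.
have /andP[_ ?] := f01 (set_coord x i true).
have /andP[? _] := f01 (set_coord x i false).
lra.
Qed.

Lemma influence_half_derivative f i : cube_monotone f ->
  cube_mean (half_derivative f i) = influence f i / 2.
Proof.
move=> mf; rewrite mulrC -cube_meanZ; apply: eq_cube_mean => x.
by rewrite /half_derivative mulrC ger0_norm // subr_ge0 cube_le_set_coord.
Qed.

Lemma fcoef_set1 f i : cube_monotone f -> fcoef f [set i]%SET = influence f i / 2.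
Proof.
move=> mf; rewrite -[[set i]%SET]finset.setU0 -fcoef_half_derivative ?finset.inE //.
rewrite -influence_half_derivative //; apply: eq_cube_mean => x.
by rewrite chi_set0 mulr1.
Qed.

Lemma influence_ge0 f i : 0 <= influence f i.
Proof. exact: cube_mean_ge0. Qed.

Lemma sum_fcoef_mem f i (P : pred {set 'I_d}) :
  \sum_(S : {set 'I_d} | (i \in S) && P S) fcoef f S ^+ 2 =
  \sum_(S : {set 'I_d} | (i \notin S) && P (i |: S)%SET)
     fcoef (half_derivative f i) S ^+ 2.
Proof.
rewrite sum_set_mem; apply: eq_bigr => S /andP[iS _].
by rewrite fcoef_half_derivative.
Qed.

Lemma ler_sum_pred (I : finType) (P Q : pred I) (F : I -> R) :
  (forall k, P k -> Q k) -> (forall k, 0 <= F k) ->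
  \sum_(k | P k) F k <= \sum_(k | Q k) F k.
Proof.
move=> PQ F0; rewrite [leLHS]big_mkcond [leRHS]big_mkcond.
apply: ler_sum => S _.
by case: ifPn => [/PQ ->//|_]; case: ifP.
Qed.

(* The edge-isoperimetric identity [sum_S |S| fcoef f S ^ 2 = sum_i E (D_i f)^2]
   together with [D_i f <= 1/2] turns the L1-influence into a spectral tail bound. *)
Lemma spectral_tail f m : (forall x, 0 <= f x <= 1) -> cube_monotone f ->
  m%:R * \sum_(S : {set 'I_d} | (m < #|S|)%N) fcoef f S ^+ 2 <=
  total_influence f / 4.
Proof.
move=> f01 mf; rewrite mulr_sumr.
apply: (@le_trans _ _ (\sum_(S : {set 'I_d}) #|S|%:R * fcoef f S ^+ 2)).
  rewrite [leLHS]big_mkcond; apply: ler_sum => S _; case: ifPn => [mS|_].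
    by rewrite ler_wpM2r ?sqr_ge0 // ler_nat ltnW.
  by rewrite mulr_ge0 // sqr_ge0.
under eq_bigr => S _ do rewrite -sum1_card natr_sum big_mkcond mulr_suml /=.
rewrite exchange_big /= /total_influence mulr_suml; apply: ler_sum => i _.
have -> : \sum_(S : {set 'I_d}) (if i \in S then 1%:R else 0) * fcoef f S ^+ 2 =
    \sum_(S : {set 'I_d} | (i \in S) && true) fcoef f S ^+ 2.
  rewrite [RHS]big_mkcond; apply: eq_bigr => S _.
  by rewrite andbT; case: ifP; rewrite ?mul1r ?mul0r.
rewrite sum_fcoef_mem.
apply: (@le_trans _ _ (sqnorm2 (half_derivative f i))).
  by rewrite parseval; apply: ler_sum_pred => // S; exact: sqr_ge0.
have -> : influence f i / 4 = 2^-1 * (influence f i / 2) by field.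
rewrite -influence_half_derivative // -cube_meanZ; apply: ler_cube_mean => x.
by rewrite expr2 ler_wpM2r ?half_derivative_ge0 ?half_derivative_le.
Qed.

(** Let [h] be the low-degree part of [g], so that [E (h g) = E (h ^ 2) = A]. Writing [|g| = s ^ 2],
    two Cauchy-Schwarz steps (Hoelder with exponents 4 and 4/3) and [bonami] give
    [A ^ 2 <= 3 ^ m * A * e ^ (3/2)]. The exponent above [1] is the gain: summed over variables, one
    factor [e] is paid by the total influence and [sqrt e] remains as a small factor. *)
Lemma low_degree_weight g m : (forall x, `|g x| <= 1) ->
  let e := cube_mean (fun x => `|g x|) in
  \sum_(S : {set 'I_d} | (#|S| <= m)%N) fcoef g S ^+ 2 <= 3 ^+ m * (e * Num.sqrt e).
Proof.
move=> g1; set e := cube_mean _ => /=; set A := (X in X <= _).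
pose h x := \sum_(S : {set 'I_d} | (#|S| <= m)%N) fcoef g S * chi S x.
have e0 : 0 <= e by apply: cube_mean_ge0.
have A0 : 0 <= A by apply: sumr_ge0 => S _; exact: sqr_ge0.
have Ehh : cube_mean (fun x => h x ^+ 2) = A by exact: parseval_sum.
have Ehg : cube_mean (fun x => h x * g x) = A.
  by rewrite cube_mean_mul_sum; apply: eq_bigr => S _; rewrite expr2.
have E4 : cube_mean (fun x => h x ^+ 4) <= 9 ^+ m * A ^+ 2.
  rewrite -Ehh.
  suff -> : h = fun x => \sum_(S : {set 'I_d} |
      (S \subset [set: 'I_d]%SET) && (#|S| <= m)%N) fcoef g S * chi S x.
    exact: bonami.
  by apply/funext => x; apply: eq_bigl => S; rewrite finset.subsetT.
pose s x := Num.sqrt `|g x|.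
have s2 x : s x ^+ 2 = `|g x| by rewrite sqr_sqrtr.
have step1 : A ^+ 2 <= cube_mean (fun x => h x ^+ 2 * `|g x|) * e.
  rewrite -Ehg; apply: (@le_trans _ _
      (cube_mean (fun x => (h x * s x) * (Num.sg (g x) * s x)) ^+ 2)).
    rewrite le_eqVlt; apply/orP; left; apply/eqP.
    congr (_ ^+ 2); apply: eq_cube_mean => x.
    by rewrite [in LHS](numEsg (g x)) -s2; ring.
  apply: (le_trans (cube_mean_CS _ _)); apply: ler_pM.
  - by apply: cube_mean_ge0 => x; exact: sqr_ge0.
  - by apply: cube_mean_ge0 => x; exact: sqr_ge0.
  - by apply: ler_cube_mean => x; rewrite exprMn s2.
  - apply: ler_cube_mean => x; rewrite exprMn s2 ler_piMl //.
    by rewrite sqr_sg; case: (_ != _).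
have step2 : cube_mean (fun x => h x ^+ 2 * `|g x|) ^+ 2 <= 9 ^+ m * A ^+ 2 * e.
  apply: (le_trans (cube_mean_CS _ _)); apply: ler_pM => //.
  - by apply: cube_mean_ge0 => x; exact: sqr_ge0.
  - by apply: cube_mean_ge0 => x; exact: sqr_ge0.
  - by under eq_cube_mean do rewrite -exprM.
  - by apply: ler_cube_mean => x; rewrite expr2 ler_piMl.
have step3 : cube_mean (fun x => h x ^+ 2 * `|g x|) <= 3 ^+ m * A * Num.sqrt e.
  have n0 : 0 <= cube_mean (fun x => h x ^+ 2 * `|g x|).
    by apply: cube_mean_ge0 => x; rewrite mulr_ge0 // sqr_ge0.
  rewrite -ler_sqr ?nnegrE // ?mulr_ge0 ?exprn_ge0 ?sqrtr_ge0 //.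
  suff -> : (3 ^+ m * A * Num.sqrt e) ^+ 2 = 9 ^+ m * A ^+ 2 * e by [].
  rewrite !exprMn sqr_sqrtr // -exprM mulnC exprM.
  by congr (_ ^+ m * _ * _); ring.
have : A * A <= A * (3 ^+ m * (e * Num.sqrt e)).
  rewrite -expr2; apply: (le_trans step1).
  have -> : A * (3 ^+ m * (e * Num.sqrt e)) = 3 ^+ m * A * Num.sqrt e * e by ring.
  exact: ler_wpM2r.
have [Ap|] := boolP (0 < A); first by rewrite ler_pM2l.
rewrite -leNgt => An _.
by rewrite (le_trans An) // mulr_ge0 ?exprn_ge0 // mulr_ge0 ?sqrtr_ge0.
Qed.

(** A set not contained in [J] has an element [i] outside [J]. Its weight is charged to every such
    [i], where it is a low-degree weight of the half derivative in direction [i]. *)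
Lemma irrelevant_weight f m J : (forall x, 0 <= f x <= 1) -> cube_monotone f ->
  \sum_(S : {set 'I_d} | (#|S| <= m)%N && ~~ (S \subset J)) fcoef f S ^+ 2 <=
  \sum_(i | i \notin J)
    3 ^+ m * (influence f i / 2 * Num.sqrt (influence f i / 2)).
Proof.
move=> f01 mf.
apply: (@le_trans _ _ (\sum_(i | i \notin J)
    \sum_(S : {set 'I_d} | (i \in S) && (#|S| <= m)%N) fcoef f S ^+ 2)).
  under [leRHS]eq_bigr do rewrite big_mkcond.
  rewrite exchange_big big_mkcond; apply: ler_sum => S _ /=.
  have n0 i : 0 <= (if (i \in S) && (#|S| <= m)%N then fcoef f S ^+ 2 else 0).
    by case: ifP => // _; exact: sqr_ge0.
  case: ifPn => [/andP[Sm /subsetPn[i iS iJ]]|_]; last exact: sumr_ge0.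
  rewrite (bigD1 i) //= iS Sm /= lerDl.
  by apply: sumr_ge0 => j _; case: ifP => // _; exact: sqr_ge0.
apply: ler_sum => i _; rewrite sum_fcoef_mem.
have g1 x : `|half_derivative f i x| <= 1.
  rewrite ger0_norm ?half_derivative_ge0 //.
  by rewrite (le_trans (half_derivative_le i x f01)) // invf_le1 // ler1n.
have := low_degree_weight m g1.
have -> : cube_mean (fun x => `|half_derivative f i x|) = influence f i / 2.
  rewrite -influence_half_derivative //; apply: eq_cube_mean => x.
  by rewrite ger0_norm // half_derivative_ge0.
move=> /= h; apply: le_trans h; apply: ler_sum_pred => [S /andP[iS]|S].
  by rewrite cardsU1 iS; exact: ltnW.
exact: sqr_ge0.
Qed.

(* Monotonicity makes each influence a degree-one Fourier coefficient, so the sum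
   over the relevant variables is controlled by Cauchy-Schwarz. *)
Lemma total_influence_junta f J (a : R) : cube_monotone f ->
  (forall x, 0 <= f x <= a) ->
  (forall i x b, i \notin J -> f (set_coord x i b) = f x) ->
  total_influence f <= 2 * a * Num.sqrt #|J|%:R.
Proof.
move=> mf fa fJ.
have a0 : 0 <= a by have /andP[x0 x1] := fa [tuple false | _ < d]; exact: le_trans x1.
have -> : total_influence f = 2 * \sum_(i in J) fcoef f [set i]%SET.
  rewrite mulr_sumr [RHS]big_mkcond; apply: eq_bigr => i _.
  rewrite fcoef_set1 // [_ * _]mulrC divfK ?pnatr_eq0 //; case: ifPn => // iJ.
  rewrite /influence -[RHS](@cube_mean_cst R d); apply: eq_cube_mean => x.
  by rewrite /discrete_derivative !fJ // subrr normr0.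
rewrite -mulrA ler_pM2l //.
pose g x := \sum_(i in J) chi [set i]%SET x : R.
have -> : \sum_(i in J) fcoef f [set i]%SET = cube_mean (fun x => f x * g x).
  rewrite -cube_mean_sum; apply: eq_cube_mean => x.
  by rewrite mulr_sumr.
have g2 : cube_mean (fun x => g x ^+ 2) = #|J|%:R.
  under eq_cube_mean do rewrite expr2 mulr_suml.
  rewrite cube_mean_sum -sum1_card natr_sum; apply: eq_bigr => i iJ.
  under eq_cube_mean do rewrite mulr_sumr.
  rewrite cube_mean_sum (bigD1 i) //= chi_orthonormal eqxx big1 ?addr0 //.
  move=> j /andP[_ ji].
  rewrite chi_orthonormal; case: eqP => // /finset.set1_inj ij.
  by rewrite ij eqxx in ji.
apply: (le_trans (ler_norm _)).
rewrite -ler_sqr ?nnegrE ?mulr_ge0 ?sqrtr_ge0 // real_normK ?num_real //.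
rewrite [leRHS]exprMn sqr_sqrtr // -g2; apply: (le_trans (cube_mean_CS _ _)).
rewrite ler_wpM2r ?g2 //.
rewrite -[leRHS](@cube_mean_cst R d); apply: ler_cube_mean => x.
by have /andP[f0 f1] := fa x; rewrite ler_sqr ?nnegrE.
Qed.

End Influences.

(** * Independence and integrals of products *)

Section IndependentIntegrals.
Local Open Scope ereal_scope.
Context {R : realType}.

Import HBNNSimple.

Section Weight.
Context {d0 d1} {T0 : measurableType d0} {T : measurableType d1}.
Variables (mu : {measure set T0 -> \bar R}) (Y : T0 -> T).
Hypothesis mY : measurable_fun setT Y.

Lemma measurable_mul_comp (W : T0 -> R) (g : T -> R) :
  measurable_fun setT W -> measurable_fun setT g ->
  measurable_fun setT (fun t => (W t * g (Y t))%:E).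
Proof.
move=> mW mg; apply/measurable_EFinP; apply: measurable_funM => //.
exact: measurableT_comp mg mY.
Qed.

(** The passage from indicators to nonnegative functions by monotone limits of simple functions:
    each side is a limit of sums in which the weight enters only through its integrals against
    indicators. *)
Lemma ge0_eq_integral_weight (W1 W2 : T0 -> R) (g : T -> R) :
  measurable_fun setT W1 -> measurable_fun setT W2 -> measurable_fun setT g ->
  (forall t, 0 <= W1 t)%R -> (forall t, 0 <= W2 t)%R -> (forall y, 0 <= g y)%R ->
  (forall A, measurable A ->
    \int[mu]_t (W1 t * \1_A (Y t))%:E = \int[mu]_t (W2 t * \1_A (Y t))%:E) ->
  \int[mu]_t (W1 t * g (Y t))%:E = \int[mu]_t (W2 t * g (Y t))%:E.
Proof.
move=> mW1 mW2 mg W10 W20 g0 H.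
have mg' : measurable_fun setT (EFin \o g) by exact/measurable_EFinP.
pose f_ := nnsfun_approx measurableT mg'.
have cvgf y : EFin \o f_ ^~ y @ \oo --> (g y)%:E.
  by apply: (@cvg_nnsfun_approx _ _ _ _ measurableT _ mg') => // x _; rewrite lee_fin.
have step (W : T0 -> R) : measurable_fun setT W -> (forall t, 0 <= W t)%R ->
    \int[mu]_t (W t * g (Y t))%:E =
    limn (fun n => \sum_(k \in range (f_ n))
      (k%:E * \int[mu]_t (W t * \1_(f_ n @^-1` [set k]) (Y t))%:E)).
  move=> mW W0.
  transitivity (limn (fun n => \int[mu]_t (W t * f_ n (Y t))%:E)).
    rewrite -monotone_convergence//.
    - apply: eq_integral => t _; apply/esym/cvg_lim => //=.
      under eq_fun do rewrite EFinM.
      rewrite EFinM; apply: cvgeZl => //; exact: cvgf.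
    - by move=> n; apply: measurable_mul_comp.
    - by move=> n t _; rewrite lee_fin mulr_ge0.
    - move=> t _ m n mn; rewrite lee_fin ler_wpM2l//.
      exact/lefP/nd_nnsfun_approx.
  congr (limn _); apply/funext => n.
  transitivity (\int[mu]_t (\sum_(k \in range (f_ n))
      (k * (W t * \1_(f_ n @^-1` [set k]) (Y t)))%:E)).
    apply: eq_integral => t _.
    rewrite fsumEFin// (fimfunE (f_ n) (Y t)); congr (_%:E).
    by rewrite mulr_fsumr; apply: eq_fsbigr => k _; rewrite mulrCA.
  rewrite ge0_integral_fsum//; first last.
  - move=> k t _; rewrite EFinM.
    have [k0|k0] := leP 0%R k; first by rewrite mule_ge0// lee_fin mulr_ge0.
    by rewrite preimage_nnfun0// indicE in_set0 mulr0 mule0.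
  - move=> k; apply/measurable_EFinP; apply: measurable_funM => //.
    by apply/measurable_EFinP; apply: measurable_mul_comp.
  apply: eq_fsbigr => k /[!inE] -[y _ <-].
  under eq_integral do rewrite EFinM.
  rewrite ge0_integralZl//.
  - by apply: measurable_mul_comp.
  - by move=> t _; rewrite lee_fin mulr_ge0.
  - by rewrite lee_fin.
rewrite (step _ mW1 W10) (step _ mW2 W20); congr (limn _); apply/funext => n.
by apply: eq_fsbigr => k _; rewrite H.
Qed.

End Weight.

(** Taking [A = setT] in the last hypothesis shows that [c] is the mean of [W]. Leaving [W] abstract
    covers both uses: a product over the other coordinates of a tuple, and the event that the design
    takes a given value. *)
Lemma ge0_integral_indep_factor {d0 d1} {T0 : measurableType d0}
    {T : measurableType d1} (P : probability T0 R) (Y : T0 -> T)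
    (W : T0 -> R) (c : R) (g : T -> R) :
  measurable_fun setT Y -> measurable_fun setT W -> measurable_fun setT g ->
  (forall t, 0 <= W t)%R -> (0 <= c)%R -> (forall y, 0 <= g y)%R ->
  (forall A, measurable A ->
    \int[P]_t (W t * \1_A (Y t))%:E = c%:E * P (Y @^-1` A)) ->
  \int[P]_t (W t * g (Y t))%:E = c%:E * \int[P]_t (g (Y t))%:E.
Proof.
move=> mY mW mg W0 c0 g0 H.
rewrite (@ge0_eq_integral_weight _ _ _ _ P Y mY W (cst c))//; last first.
  move=> A mA; rewrite H//.
  have mYA : measurable (Y @^-1` A) by rewrite -[_ @^-1` _]setTI; exact: mY.
  under eq_integral do rewrite EFinM /=.
  rewrite ge0_integralZl//; first by rewrite (integral_indic _ measurableT mYA) setIT.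
  by apply/measurable_EFinP; exact: measurable_indic.
under eq_integral do rewrite EFinM /=.
rewrite ge0_integralZl//.
- by apply/measurable_EFinP; exact: measurableT_comp mg mY.
- by move=> t _; rewrite lee_fin.
Qed.

(** Independence is given for sets, so indicators are traded for functions one coordinate at a time:
    in [h k A] the first [k] factors are the [g i] and the others are indicators. Finiteness of the
    integrals makes the product over the other coordinates a real constant. *)
Lemma integral_prod_indep {d1} {T : measurableType d1} {n : nat}
    (Q : probability (n.-tuple T) R) (g : 'I_n -> T -> R) :
  independent_coords Q ->
  (forall i, measurable_fun setT (g i)) -> (forall i y, 0 <= g i y)%R ->
  (forall i, \int[Q]_t (g i (tnth t i))%:E < +oo) ->
  \int[Q]_t (\prod_(i < n) g i (tnth t i))%:E =
  \prod_(i < n) \int[Q]_t (g i (tnth t i))%:E.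
Proof.
move=> iQ mg g0 gfin.
pose h (k : nat) (A : 'I_n -> set T) (i : 'I_n) : T -> R :=
  if (i < k)%N then g i else \1_(A i).
have mh k A i : (forall i, measurable (A i)) -> measurable_fun setT (h k A i).
  by move=> mA; rewrite /h; case: ifP => // _; exact: measurable_indic.
have h0 k A i y : (0 <= h k A i y)%R by rewrite /h; case: ifP.
have mtn i : measurable_fun setT (fun t : n.-tuple T => tnth t i).
  exact: measurable_tnth.
have mpre i A : measurable A -> measurable [set t : n.-tuple T | A (tnth t i)].
  by move=> mA; have := mtn i measurableT _ mA; rewrite setTI.
have intind i A : measurable A ->
    \int[Q]_t (\1_A (tnth t i))%:E = Q [set t | A (tnth t i)].
  move=> mA.
  by rewrite (integral_indic _ measurableT (mpre i _ mA)) setIT.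
have hfin k A i : (forall i, measurable (A i)) ->
    \int[Q]_t (h k A i (tnth t i))%:E < +oo.
  move=> mA; rewrite /h; case: ifP => // _.
  by rewrite intind // (le_lt_trans (probability_le1 _ _))// ?ltry//; exact: mpre.
suff key k : (k <= n)%N -> forall A, (forall i, measurable (A i)) ->
    \int[Q]_t (\prod_(i < n) h k A i (tnth t i))%:E =
    \prod_(i < n) \int[Q]_t (h k A i (tnth t i))%:E.
  have := key n (leqnn n) (fun _ => setT) (fun _ => measurableT).
  rewrite /h; under eq_integral do under eq_bigr do rewrite ltn_ord.
  by under [in RHS]eq_bigr do rewrite ltn_ord.
elim: k => [_|k IH kn] A mA.
  rewrite [RHS](eq_bigr (fun i => Q [set t | A i (tnth t i)])); last first.
    by move=> i _; rewrite /h ltn0 intind.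
  rewrite -iQ// -[in RHS](setIT [set t | _]) -integral_indic//; last first.
    rewrite (_ : [set t | _] = \bigcap_(i in setT) [set t | A i (tnth t i)]).
      by apply: fin_bigcap_measurable => // i _; exact: mpre.
    by apply/seteqP; split => t /= h1 i; [move=> _; exact: h1|exact: h1].
  apply: eq_integral => t _; congr (_%:E); rewrite indicE.
  have [/= tA|/= tA] := boolP (t \in _).
    by rewrite big1// => i _; rewrite /h ltn0 indicE mem_set//; move: tA; rewrite inE.
  have [i Ai] : exists i, ~ A i (tnth t i).
    apply/existsNP => H; move: tA; rewrite notin_setE; exact.
  by rewrite (bigD1 i)//= /h ltn0 indicE memNset// mul0r.
pose i0 := Ordinal kn.
have hne (B : 'I_n -> set T) i : i != i0 -> (forall j, j != i0 -> B j = A j) ->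
    h k.+1 A i = h k B i.
  move=> ii0 BA; rewrite /h ltnS leq_eqVlt.
  have /negbTE -> : (i : nat) != k by apply: contra ii0 => /eqP ik; apply/eqP/val_inj.
  by rewrite BA.
pose W t := (\prod_(i < n | i != i0) h k.+1 A i (tnth t i))%R.
pose C := \prod_(i < n | i != i0) \int[Q]_t (h k.+1 A i (tnth t i))%:E.
have C0 : 0 <= C.
  by apply: prode_ge0 => i _; apply: integral_ge0 => t _; rewrite lee_fin.
have Cfin : C \is a fin_num.
  apply: (big_ind (fun x : \bar R => x \is a fin_num)) => //.
    by move=> x y; exact: fin_numM.
  move=> i _; rewrite ge0_fin_numE; first exact: hfin.
  by apply: integral_ge0 => t _; rewrite lee_fin.
rewrite [RHS](bigD1 i0)//= -/C {2}/h /= ltnS leqnn.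
under eq_integral do rewrite (bigD1 i0)//= -/(W _) {1}/h ltnS leqnn mulrC.
rewrite muleC -(fineK Cfin).
apply: ge0_integral_indep_factor => //.
- rewrite (_ : W = fun t => (\prod_(i <- [seq i <- index_enum 'I_n | i != i0])
      h k.+1 A i (tnth t i))%R); last by apply/funext => t; rewrite big_filter.
  apply: measurable_prod => i _.
  by apply: measurableT_comp (mtn i); exact: mh.
- by move=> t; apply: prodr_ge0.
- by rewrite fine_ge0.
move=> B mB.
(* The set at index [k] becomes the test set [B]; this is why the induction quantifies over all
   families [A]. *)
pose A' i := if i == i0 then B else A i.
have mA' i : measurable (A' i) by rewrite /A'; case: eqP.
have A'A j : j != i0 -> A' j = A j by rewrite /A' => /negbTE ->.
have := IH (ltnW kn) A' mA'.
rewrite [RHS](bigD1 i0)//= {2}/h /= ltnn /A' eqxx intind// -/A'.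
rewrite (eq_bigr (fun i => \int[Q]_t (h k.+1 A i (tnth t i))%:E)); last first.
  by move=> i ii0; apply: eq_integral => t _; rewrite (hne A').
rewrite -/C (fineK Cfin) muleC => <-.
apply: eq_integral => t _; congr (_%:E).
rewrite [RHS](bigD1 i0)//= {1}/h ltnn /A' eqxx -/A' mulrC; congr (_ * _)%R.
by apply: eq_bigr => i ii0; rewrite (hne A').
Qed.

End IndependentIntegrals.

(** * Moment generating functions of empirical coefficients *)

(** Squaring [1 - u / 2 <= expR (- u / 2)] bounds [expR u] by [(1 - u / 2) ^- 2]. The comparison
    with the quadratic then comes down to [1 - 3 * u + u ^ 2 >= 0], whence the radius [1/3]. *)
Lemma expR_le_quad (R : realType) (u : R) : `|u| <= 3^-1 ->
  expR u <= 1 + u + u ^+ 2.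
Proof.
rewrite ler_norml => /andP[u1 u2].
have v1 : 1 - u / 2 <= expR (- (u / 2)) by exact: expR_ge1Dx.
have u0 : 0 < 1 - u / 2 by lra.
have E : expR u * expR (- (u / 2)) ^+ 2 = 1.
  by rewrite -expRM_natl -expRD (_ : _ + _ = 0) ?expR0 //; field.
have h1 : expR u * (1 - u / 2) ^+ 2 <= 1.
  by rewrite -[leRHS]E ler_wpM2l ?expR_ge0 // ler_sqr ?nnegrE ?(ltW u0) ?expR_ge0.
have h2 : 1 <= (1 + u + u ^+ 2) * (1 - u / 2) ^+ 2.
  rewrite -subr_ge0 (_ : _ - _ = u ^+ 2 / 4 * (1 - 3 * u + u ^+ 2)); last by field.
  rewrite mulr_ge0 ?divr_ge0 ?sqr_ge0 //.
  by have := sqr_ge0 u; lra.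
by rewrite -(ler_pM2r (exprn_gt0 2 u0)) (le_trans h1).
Qed.

Lemma lee_prod_nneg (R : realDomainType) (I : Type) (r : seq I) (P : pred I)
    (a b : I -> \bar R) :
  (forall i, P i -> (0 <= a i <= b i)%E) ->
  (0 <= \prod_(i <- r | P i) a i <= \prod_(i <- r | P i) b i)%E.
Proof.
move=> ab; elim/big_ind2 : _ => // [|x1 x2 y1 y2 /andP[? ?] /andP[? ?]].
  by rewrite lexx lee_fin ler01.
by rewrite mule_ge0 //= lee_pmul.
Qed.

Lemma measurable_tuple_set1 {d} {T : measurableType d} {n} (x : n.-tuple T) :
  (forall y : T, measurable [set y]) -> measurable [set x].
Proof.
move=> mT.
rewrite (_ : [set x] = \bigcap_(i in [set: 'I_n]) (@tnth n T ^~ i @^-1` [set tnth x i])).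
  apply: fin_bigcap_measurable => // i _.
  by rewrite -[_ @^-1` _]setTI; exact: (measurable_tnth i).
apply/seteqP; split => t /=; first by move=> -> i.
by move=> H; apply: eq_from_tnth => i; exact: H.
Qed.

Lemma measurable_cube {d} (A : set (cube d)) : measurable A.
Proof.
rewrite (_ : A = \bigcup_(x in A) [set x]); last by rewrite bigcup_imset1 image_id.
apply: fin_bigcup_measurable => [|x _]; first exact: finite_finset.
exact: measurable_tuple_set1.
Qed.

Lemma measurable_design {d n} (A : set (n.-tuple (cube d))) : measurable A.
Proof.
rewrite (_ : A = \bigcup_(x in A) [set x]); last by rewrite bigcup_imset1 image_id.
apply: fin_bigcup_measurable => [|x _]; first exact: finite_finset.
by apply: measurable_tuple_set1 => y; exact: measurable_cube.
Qed.

Section MomentGenerating.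
Context {R : realType} {d n : nat}.

Definition deviation (f : cube d -> R) (S : {set 'I_d})
    (s : n.-tuple (cube d * R)) : R :=
  \sum_(j < n) ((tnth s j).2 * chi S (tnth s j).1 - fcoef f S).

Lemma noise_mgf (sigma : R) (Q : probability (n.-tuple R) R) (a : 'I_n -> R) t :
  admissible_noise sigma Q -> (forall j, `|a j| = 1) ->
  (\int[Q]_e (expR (t * \sum_(j < n) a j * tnth e j))%:E <=
   (expR (n%:R * (sigma ^+ 2 * t ^+ 2 / 2)))%:E)%E.
Proof.
move=> [iQ _ mgf] a1.
pose g j y := expR (t * a j * y).
have gle j : (\int[Q]_e (g j (tnth e j))%:E <= (expR (sigma ^+ 2 * t ^+ 2 / 2))%:E)%E.
  have := mgf j (t * a j); rewrite unlock.
  by rewrite exprMn -[a j ^+ 2]real_normK ?num_real // a1 expr1n mulr1.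
have g0 j : (0 <= \int[Q]_e (g j (tnth e j))%:E)%E.
  by apply: integral_ge0 => e _; rewrite lee_fin expR_ge0.
have -> : (\int[Q]_e (expR (t * \sum_(j < n) a j * tnth e j))%:E =
    \prod_(j < n) \int[Q]_e (g j (tnth e j))%:E)%E.
  rewrite -integral_prod_indep //.
  - apply: eq_integral => e _; rewrite mulr_sumr expR_sum.
    by under eq_bigr do rewrite mulrA.
  - move=> j; apply: measurableT_comp => //; exact: measurable_funM.
  - by move=> j y; exact: expR_ge0.
  - by move=> j; rewrite (le_lt_trans (gle j)) // ltry.
have /andP[_] := @lee_prod_nneg R _ (index_enum 'I_n) xpredT
  (fun j => \int[Q]_e (g j (tnth e j))%:E)%E
  (fun _ => (expR (sigma ^+ 2 * t ^+ 2 / 2))%:E)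
  (fun j _ => introT andP (conj (g0 j) (gle j))).
move=> /le_trans; apply.
by rewrite prodEFin prodr_const card_ord expRM_natl.
Qed.

(** The centered variable is bounded by [2], so [|t| <= 1/6] brings the exponent into the range of
    [expR_le_quad]. The linear term has mean zero and the variance is at most [1]. *)
Lemma design_mgf (f : cube d -> R) S t :
  (forall x, 0 <= f x <= 1) -> `|t| <= 6^-1 ->
  cube_mean (fun x => expR (t * (f x * chi S x - fcoef f S))) <= expR (t ^+ 2).
Proof.
move=> f01 t6.
have fc x : `|f x * chi S x| <= 1.
  by rewrite normrM normr_chi mulr1; have /andP[f0 f1] := f01 x; rewrite ger0_norm.
have fS : `|fcoef f S| <= 1.
  rewrite ler_norml; apply/andP; split.
    rewrite -[leLHS](@cube_mean_cst R d); apply: ler_cube_mean => x.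
    by have := fc x; rewrite ler_norml => /andP[].
  rewrite -[leRHS](@cube_mean_cst R d); apply: ler_cube_mean => x.
  by have := fc x; rewrite ler_norml => /andP[].
have E1 : cube_mean (fun x => f x * chi S x) = fcoef f S by [].
move: (fcoef f S) E1 fS => c E1 fS.
apply: (@le_trans _ _ (cube_mean (fun x =>
    1 + t * (f x * chi S x - c) + (t * (f x * chi S x - c)) ^+ 2))).
  apply: ler_cube_mean => x; apply: expR_le_quad.
  rewrite normrM (_ : 3^-1 = 6^-1 * 2 :> R); last by field.
  by apply: ler_pM => //; rewrite (le_trans (ler_normB _ _)) // -[2]/(1 + 1) lerD.
apply: (@le_trans _ _ (1 + t ^+ 2)); last exact: expR_ge1Dx.

have E2 : cube_mean (fun x => (f x * chi S x) ^+ 2) <= 1.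
  rewrite -[leRHS](@cube_mean_cst R d); apply: ler_cube_mean => x.
  by rewrite -real_normK ?num_real // expr_le1.
have -> : cube_mean (fun x =>
    1 + t * (f x * chi S x - c) + (t * (f x * chi S x - c)) ^+ 2) =
    cube_mean (fun x => (1 - t * c + t ^+ 2 * c ^+ 2) +
      ((t - 2 * t ^+ 2 * c) * (f x * chi S x) + t ^+ 2 * (f x * chi S x) ^+ 2)).
  by apply: eq_cube_mean => x; ring.
rewrite cube_meanD cube_mean_cst cube_meanD 2!cube_meanZ E1.
move: (cube_mean _) E2 => v E2.
have -> : 1 - t * c + t ^+ 2 * c ^+ 2 + ((t - 2 * t ^+ 2 * c) * c + t ^+ 2 * v) =
    1 + t ^+ 2 * (v - c ^+ 2) by ring.
by rewrite lerD2l ler_piMr ?sqr_ge0 // lerBlDr (le_trans E2) // lerDl sqr_ge0.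
Qed.

Lemma iid_uniform_point (Q : probability (n.-tuple (cube d)) R) x :
  iid_uniform Q -> Q [set x] = ((2 ^+ d)^-1 ^+ n)%:E.
Proof.
move=> [iQ uQ]; have := iQ (fun i => [set tnth x i]) (fun i => measurable_cube _).
rewrite (eq_bigr (fun _ => ((2 ^+ d)^-1)%:E)); last by move=> i _; exact: uQ.
rewrite prodEFin prodr_const card_ord => <-; congr (Q _).
apply/seteqP; split => t /=; first by move-> => i.
by move=> H; apply: eq_from_tnth.
Qed.

(** The deviation is a design term plus a sum of the noise with signs [chi S (X_j)]. Splitting over
    the finitely many values of the design freezes these signs; [noise_mgf] then bounds the noise
    factor uniformly in the design, and the design factor is a product of cube averages. *)
Lemma deviation_mgf {dO} {Om : measurableType dO} (sigma : R)
    (P : probability Om R) (X : {RV P >-> n.-tuple (cube d)})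
    (e : {RV P >-> n.-tuple R}) (f : cube d -> R) S t :
  sampling_model sigma X e -> (forall x, 0 <= f x <= 1) -> `|t| <= 6^-1 ->
  (\int[P]_w (expR (t * deviation f S (sample f (X w) (e w))))%:E <=
   (expR (n%:R * ((sigma ^+ 2 / 2 + 1) * t ^+ 2)))%:E)%E.
Proof.
move=> [iidX adm indep] f01 t6.
pose c (x : n.-tuple (cube d)) :=
  \prod_(j < n) expR (t * (f (tnth x j) * chi S (tnth x j) - fcoef f S)).
pose g (x : n.-tuple (cube d)) (y : n.-tuple R) :=
  expR (t * \sum_(j < n) chi S (tnth x j) * tnth y j).
pose q : R := (2 ^+ d)^-1 ^+ n.
pose M := expR (n%:R * (sigma ^+ 2 * t ^+ 2 / 2)).
have c0 x : 0 <= c x by apply: prodr_ge0 => j _; exact: expR_ge0.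
have q0 : 0 <= q by rewrite exprn_ge0 // invr_ge0 exprn_ge0.
have mg x : measurable_fun setT (g x).
  apply: measurableT_comp => //; apply: measurable_funM => //.
  apply: measurable_sum => j; apply: measurable_funM => //.
  exact: measurable_tnth.
have mX x : measurable (X @^-1` [set x]).
  rewrite -[_ @^-1` _]setTI.
  by apply: (measurable_funP X) => //; exact: measurable_design.
have me : measurable_fun setT e by exact: measurable_funP.
have PX x : P (X @^-1` [set x]) = q%:E.
  by rewrite /q -(iid_uniform_point x iidX).
have mind x : measurable_fun setT (\1_(X @^-1` [set x]) : Om -> R).
  exact: measurable_indic.
have Eint w : expR (t * deviation f S (sample f (X w) (e w))) =
    \sum_(x : n.-tuple (cube d)) c x * (\1_(X @^-1` [set x]) w * g x (e w)).
  rewrite (bigD1 (X w)) //= big1 ?addr0 => [|x xX]; last first.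
    rewrite indicE memNset ?mul0r ?mulr0 //= => Xx.
    by rewrite Xx eqxx in xX.
  rewrite indicE mem_set //= mul1r /c -expR_sum -expRD -mulr_sumr -mulrDr -big_split.
  congr (expR (t * _)); apply: eq_bigr => j _.
  by rewrite tnth_mktuple /=; ring.
under eq_integral do rewrite Eint -sumEFin.
rewrite ge0_integral_sum //; first last.
  by move=> x w _; rewrite lee_fin !mulr_ge0 ?expR_ge0.
  move=> x; apply/measurable_EFinP; apply: measurable_funM => //.
  by apply: measurable_funM => //; exact: measurableT_comp (mg x) me.
apply: (@le_trans _ _ (\sum_(x : n.-tuple (cube d)) (c x * (q * M))%:E)%E).
  apply: lee_sum => x _.
  under eq_integral do rewrite EFinM.
  rewrite ge0_integralZl ?lee_fin //; first last.
    by move=> w _; rewrite lee_fin mulr_ge0 ?expR_ge0.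
    apply/measurable_EFinP.
    by apply: measurable_funM => //; exact: measurableT_comp (mg x) me.
  rewrite EFinM lee_wpmul2l ?lee_fin //.
  rewrite (@ge0_integral_indep_factor _ _ _ _ _ P e _ q) //; first last.
  - move=> A mA; have mA' : measurable (e @^-1` A).
      by rewrite -[_ @^-1` _]setTI; exact: me.
    have := indep [set x] A (measurable_design _) mA; rewrite PX => <-.
    rewrite -[in RHS](setIT (_ `&` _)) -integral_indic //; last exact: measurableI.
    by apply: eq_integral => w _; rewrite indicI.
  - by move=> y; exact: expR_ge0.
  rewrite EFinM lee_wpmul2l ?lee_fin //.
  have := @noise_mgf sigma (distribution P e) (fun j => chi S (tnth x j)) t adm
    (fun j => normr_chi S _).
  rewrite ge0_integral_distribution //.
  by apply/measurable_EFinP; exact: mg.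
rewrite sumEFin lee_fin -mulr_suml.
rewrite (sum_tuple_prod (fun _ y => expR (t * (f y * chi S y - fcoef f S)))).
rewrite prodr_const card_ord [leLHS]mulrA.
have -> : (\sum_y expR (t * (f y * chi S y - fcoef f S))) ^+ n * q =
    cube_mean (fun y => expR (t * (f y * chi S y - fcoef f S))) ^+ n.
  by rewrite /q /cube_mean exprMn mulrC.
have -> : n%:R * ((sigma ^+ 2 / 2 + 1) * t ^+ 2) =
    n%:R * t ^+ 2 + n%:R * (sigma ^+ 2 * t ^+ 2 / 2) by ring.
rewrite expRD ler_wpM2r ?expR_ge0 // expRM_natl lerXn2r ?nnegrE ?expR_ge0 //.
  by apply: cube_mean_ge0 => x; exact: expR_ge0.
exact: design_mgf.
Qed.

End MomentGenerating.

(** * The low-degree estimator *)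

Section Estimator.
Context {R : realType} {d n : nat}.
Implicit Types (s : n.-tuple (cube d * R)) (S J : {set 'I_d}) (f : cube d -> R).

Definition emp_coef S s : R :=
  n%:R^-1 * \sum_(j < n) (tnth s j).2 * chi S (tnth s j).1.

Definition selected (tau : R) s : {set 'I_d} :=
  [set i | tau <= emp_coef [set i]%SET s]%SET.

Definition clip (y : R) : R := Num.max 0 (Num.min 1 y).

Definition low_degree_poly (m : nat) (tau : R) s (x : cube d) : R :=
  \sum_(S : {set 'I_d} | (S \subset selected tau s) && (#|S| <= m)%N)
    emp_coef S s * chi S x.

Definition low_degree_estimator (m : nat) (tau : R) s (x : cube d) : R :=
  clip (low_degree_poly m tau s x).

Lemma measurable_emp_coef S : measurable_fun setT (emp_coef S).
Proof.
apply: measurable_funM => //; apply: measurable_sum => j.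
have mj : measurable_fun setT (fun s => tnth s j) by exact: measurable_tnth.
apply: measurable_funM; first exact: measurableT_comp measurable_snd mj.
have mchi : measurable_fun setT (@chi R d S) by move=> _ Y _; exact: measurable_cube.
exact: measurableT_comp mchi (measurableT_comp measurable_fst mj).
Qed.

(** Turns the data-dependent range of summation of the estimator into a product of measurable
    factors. *)
Lemma prod_indicator_subset S (b : pred 'I_d) :
  \prod_(i in S) (if b i then 1 else 0) = (S \subset [set i | b i]%SET)%:R :> R.
Proof.
have [/fintype.subsetP H|/subsetPn[i iS ib]] := boolP (S \subset _).
  by rewrite big1 // => i /H; rewrite finset.inE => ->.
by rewrite (bigD1 i) //=; move: ib; rewrite finset.inE => /negbTE ->; rewrite mul0r.
Qed.

Lemma estimator_low_degree m tau : estimator R d n (low_degree_estimator m tau).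
Proof.
move=> x; apply: measurable_maxr => //; apply: measurable_minr => //.
rewrite (_ : (fun s => low_degree_poly m tau s x) = (fun s =>
    \sum_(S <- [seq S : {set 'I_d} <- index_enum {set 'I_d} | (#|S| <= m)%N])
     (\prod_(i <- [seq i <- index_enum 'I_d | i \in S])
        (if tau <= emp_coef [set i]%SET s then 1 else 0)) *
      (emp_coef S s * chi S x))); last first.
  apply/funext => s; rewrite big_filter.
  rewrite /low_degree_poly big_mkcondl; apply: eq_bigr => S _.
  rewrite big_filter (prod_indicator_subset S (fun i => tau <= emp_coef [set i]%SET s)).
  by rewrite -/(selected tau s); case: ifP; rewrite ?mul1r ?mul0r.
apply: measurable_sum => S; apply: measurable_funM.
  apply: measurable_prod => i _.
  apply: measurable_fun_if => //; apply: measurable_fun_ler => //.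
  exact: measurable_emp_coef.
by apply: measurable_funM => //; exact: measurable_emp_coef.
Qed.

Lemma clip_contraction (y z : R) : 0 <= z <= 1 -> (clip y - z) ^+ 2 <= (y - z) ^+ 2.
Proof.
move=> /andP[z0 z1]; rewrite /clip.
have [y1|y1] := leP 1 y; last have [y0|y0] := leP y 0.
- rewrite max_r // -subr_ge0.
  have -> : (y - z) ^+ 2 - (1 - z) ^+ 2 = (y - 1) * (y + 1 - 2 * z) by ring.
  by apply: mulr_ge0; lra.
- rewrite -subr_ge0.
  have -> : (y - z) ^+ 2 - (0 - z) ^+ 2 = (- y) * (2 * z - y) by ring.
  by apply: mulr_ge0; lra.
- by [].
Qed.

Lemma sqnorm2_clip_le1 (g : cube d -> R) f : (forall x, 0 <= f x <= 1) ->
  sqnorm2 (fun x => clip (g x) - f x) <= 1.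
Proof.
move=> f01; rewrite -[leRHS](@cube_mean_cst R d); apply: ler_cube_mean => x.
have /andP[f0 f1] := f01 x.
have c0 : 0 <= clip (g x) by rewrite /clip le_max lexx.
have c1 : clip (g x) <= 1 by rewrite /clip ge_max ler01 ge_min lexx.
rewrite -real_normK ?num_real // expr_le1 // ler_norml; lra.
Qed.

Lemma emp_coef_deviation f S s : (0 < n)%N ->
  emp_coef S s - fcoef f S = n%:R^-1 * deviation f S s.
Proof.
move=> n0; rewrite /deviation sumrB mulrBr; congr (_ - _).
rewrite sumr_const card_ord -(mulr_natl (fcoef f S)) mulrA mulVf ?mul1r //.
by rewrite pnatr_eq0 -lt0n.
Qed.

(** Since [f] takes values in [[0, 1]], clipping only helps, and Parseval splits the remaining error
    into estimation of the retained coefficients, high degrees, and low-degree sets meeting an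
    unselected variable. *)
Lemma loss_low_degree m (tau : R) f s :
  (forall x, 0 <= f x <= 1) ->
  sqnorm2 (fun x => low_degree_estimator m tau s x - f x) <=
  \sum_(S : {set 'I_d} | (S \subset selected tau s) && (#|S| <= m)%N)
     (emp_coef S s - fcoef f S) ^+ 2 +
  (\sum_(S : {set 'I_d} | (m < #|S|)%N) fcoef f S ^+ 2 +
   \sum_(S : {set 'I_d} | (#|S| <= m)%N && ~~ (S \subset selected tau s))
      fcoef f S ^+ 2).
Proof.
move=> f01; pose A S := (S \subset selected tau s) && (#|S| <= m)%N.
pose c S := (if A S then emp_coef S s else 0) - fcoef f S.
apply: (@le_trans _ _ (\sum_S c S ^+ 2)).
  rewrite -parseval_sum; apply: ler_cube_mean => x.
  have -> : \sum_S c S * chi S x = low_degree_poly m tau s x - f x.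
    rewrite (fourier_inversion f x) /low_degree_poly [in RHS]big_mkcond -sumrB.
    by apply: eq_bigr => S _; rewrite /c mulrBl -/(A S); case: ifP; rewrite ?mul0r.
  exact: clip_contraction.
rewrite (bigID A) /=; apply: lerD.
  by apply: ler_sum => S AS; rewrite /c AS.
rewrite (bigID (fun S => (m < #|S|)%N)) /=; apply: lerD.
  rewrite (eq_bigl (fun S : {set 'I_d} => (m < #|S|)%N)).
    apply: ler_sum => S mS.
    by rewrite /c /A leqNgt mS andbF add0r sqrrN.
  by move=> S; rewrite /A ltnNge; case: (S \subset _); case: (_ <= _)%N.
rewrite (eq_bigl (fun S : {set 'I_d} => (#|S| <= m)%N && ~~ (S \subset selected tau s))).
  apply: ler_sum => S /andP[_ /negbTE mS].
  by rewrite /c /A mS /= add0r sqrrN.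
by move=> S; rewrite /A -leqNgt; case: (S \subset _); case: (_ <= _)%N.
Qed.

(** A deterministic set that contains [selected tau s] on the good event, so that the estimation
    error is summed over a family independent of the sample. *)
Definition influential f (tau : R) : {set 'I_d} := [set i | tau <= influence f i]%SET.

Lemma loss_good_event m (tau K : R) f s : (0 < m)%N -> tau = 36 ^- m ->
  (forall x, 0 <= f x <= 1) -> cube_monotone f -> total_influence f <= K ->
  (forall i, `|emp_coef [set i]%SET s - fcoef f [set i]%SET| <= tau / 2) ->
  sqnorm2 (fun x => low_degree_estimator m tau s x - f x) <=
  \sum_(S : {set 'I_d} | (S \subset influential f tau) && (#|S| <= m)%N)
     (emp_coef S s - fcoef f S) ^+ 2 + 2 * K / m%:R.
Proof.
move=> m0 tauE f01 mf fK good.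
have I0 i := influence_ge0 f i.
have K0 : 0 <= K by rewrite (le_trans _ fK) // sumr_ge0.
(* The coefficient of [{i}] is half the influence, so an error of at most [tau / 2] means that a
   selected variable has influence at least [tau] and an unselected one less than [3 * tau]. *)
have good' i : - (tau / 2) <= emp_coef [set i]%SET s - influence f i / 2 <= tau / 2.
  by rewrite -ler_norml -fcoef_set1.
apply: (le_trans (loss_low_degree _ _ _ f01)); apply: lerD.
  apply: ler_sum_pred => [S /andP[SJ ->]|S]; last exact: sqr_ge0.
  rewrite andbT; apply: (fintype.subset_trans SJ); apply/fintype.subsetP => i.
  by rewrite !finset.inE => h; have /andP[_ h2] := good' i; lra.
have m0' : 0 < m%:R :> R by rewrite ltr0n.
have -> : 2 * K / m%:R = K / m%:R + K / m%:R by field; rewrite gt_eqF.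
apply: lerD.
  rewrite ler_pdivlMr // mulrC (le_trans (spectral_tail m f01 mf)) // ler_pdivrMr //.
  by rewrite (le_trans fK) // ler_peMr // ler1n.
apply: (le_trans (irrelevant_weight m _ f01 mf)).
have tau0 : 0 < tau by rewrite tauE invr_gt0 exprn_gt0.
(* Origin of the base 36: its square root [6] beats the hypercontractive factor [3] and leaves
   [2 ^- m], which is at most [1 / m]. *)
have sq_tau : Num.sqrt (3 * tau / 2) <= 2 * 6 ^- m.
  rewrite -[leRHS]ger0_norm ?mulr_ge0 ?invr_ge0 ?exprn_ge0 //.
  rewrite -sqrtr_sqr ler_sqrt ?sqr_ge0 //.
  have -> : (2 * 6 ^- m) ^+ 2 = 4 * tau :> R.
    rewrite exprMn exprVn -exprM mulnC exprM tauE; congr (_ * (_ ^+ m)^-1); ring.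
  lra.
apply: (@le_trans _ _ (\sum_(i | i \notin selected tau s)
    3 ^+ m * (influence f i / 2 * (2 * 6 ^- m)))).
  apply: ler_sum => i; rewrite finset.inE -ltNge => h.
  rewrite ler_wpM2l ?exprn_ge0 // ler_wpM2l ?divr_ge0 // (le_trans _ sq_tau) //.
  rewrite ler_sqrt; last by rewrite divr_ge0 // mulr_ge0 // ltW.
  by have /andP[h2 _] := good' i; lra.
apply: (@le_trans _ _ (\sum_(i < d) influence f i * 2 ^- m)).
  rewrite big_mkcond; apply: ler_sum => i _.
  have E : 3 ^+ m * (influence f i / 2 * (2 * 6 ^- m)) = influence f i * 2 ^- m.
    have -> : 6 ^+ m = 2 ^+ m * 3 ^+ m :> R by rewrite -exprMn; congr (_ ^+ m); ring.
    by field; rewrite !expf_neq0.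
  by rewrite E; case: ifP => // _; rewrite mulr_ge0 // invr_ge0 exprn_ge0.
rewrite -mulr_suml; apply: ler_pM => //.
  by rewrite sumr_ge0.
rewrite lef_pV2 ?posrE ?exprn_gt0 //.
by rewrite -natrX ler_nat ltnW // ltn_expl.
Qed.

(* Each [S] made of influential variables satisfies
   [1 <= y^-m * \prod_(i in S) (y * I_i / tau)] with [y = tau / K], and the sum of
   these products over all [S] factorizes. *)
Lemma card_influential_sets m (tau K : R) f : 0 < tau -> tau <= 1 -> 1 <= K ->
  total_influence f <= K ->
  \sum_(S : {set 'I_d} | (S \subset influential f tau) && (#|S| <= m)%N) 1 <=
  expR 1 * (K / tau) ^+ m.
Proof.
move=> tau0 tau1 K1 fK.
have K0 : 0 < K by exact: lt_le_trans K1.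
pose z i := influence f i / K.
have z0 i : 0 <= z i by rewrite divr_ge0 ?influence_ge0 ?ltW.
apply: (@le_trans _ _ (\sum_(S : {set 'I_d}) (K / tau) ^+ m * \prod_(i in S) z i)).
  rewrite [leLHS]big_mkcond; apply: ler_sum => S _.
  have pz : 0 <= \prod_(i in S) z i by exact: prodr_ge0.
  have Kt1 : 1 <= K / tau by rewrite ler_pdivlMr // mul1r (le_trans tau1).
  case: ifPn => [/andP[/fintype.subsetP SI Sm]|_]; last first.
    by rewrite mulr_ge0 // exprn_ge0 // (le_trans ler01).
  apply: (@le_trans _ _ ((K / tau) ^+ #|S| * \prod_(i in S) z i)); last first.
    by rewrite ler_wpM2r // ler_weXn2l.
  rewrite -prodr_const -big_split /=.
  rewrite -[leLHS](_ : \prod_(i in S) (1 : R) = 1); last by rewrite big1.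
  apply: ler_prod => i /SI; rewrite finset.inE => iI.
  rewrite ler01 /= /z (_ : K / tau * (influence f i / K) = influence f i / tau).
    by rewrite ler_pdivlMr // mul1r.
  by field; rewrite !gt_eqF.
rewrite -mulr_sumr sum_prod_set mulrC ler_wpM2r //.
  by rewrite exprn_ge0 // divr_ge0 // ltW.
apply: (@le_trans _ _ (\prod_i expR (z i))).
  apply: ler_prod => i _; rewrite expR_ge1Dx andbT.
  by rewrite addr_ge0.
by rewrite -expR_sum ler_expR -mulr_suml ler_pdivrMr // mul1r.
Qed.

(** Lets the squared error of a coefficient be read off from the moment generating function, without
    a separate variance computation. *)
Lemma sqr_le_expR (u : R) : u ^+ 2 <= 2 * (expR u + expR (- u)).
Proof.
have h : 1 + `|u| ^+ 2 / 2 <= expR `|u| by apply: (expR_ge1Dxn 1).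
have h2 : expR `|u| <= expR u + expR (- u).
  have [u0|u0] := leP 0 u; first by rewrite ger0_norm // lerDl expR_ge0.
  by rewrite ltr0_norm // lerDr expR_ge0.
by rewrite -real_normK ?num_real //; lra.
Qed.

(** Holds for every sample, whether or not the good event occurs. The parameters are separate
    because [t1] serves a second moment and [t2] a tail, which call for different scales. *)
Lemma loss_exponential m (tau K t1 t2 : R) f s : (0 < n)%N -> (0 < m)%N ->
  tau = 36 ^- m -> 0 < t1 -> 0 < t2 ->
  (forall x, 0 <= f x <= 1) -> cube_monotone f -> total_influence f <= K ->
  sqnorm2 (fun x => low_degree_estimator m tau s x - f x) <=
  2 * K / m%:R +
  \sum_(S : {set 'I_d} | (S \subset influential f tau) && (#|S| <= m)%N)
     2 / (t1 * n%:R) ^+ 2 *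
       (expR (t1 * deviation f S s) + expR (- t1 * deviation f S s)) +
  \sum_(i < d) expR (- (t2 * n%:R * tau / 2)) *
     (expR (t2 * deviation f [set i]%SET s) + expR (- t2 * deviation f [set i]%SET s)).
Proof.
move=> n0 m0 tauE t10 t20 f01 mf fK.
have nR : 0 < n%:R :> R by rewrite ltr0n.
have K0 : 0 <= K by rewrite (le_trans _ fK) // sumr_ge0 // => i _; exact: influence_ge0.
have ex0 := @expR_ge0 R.
have T0 : 0 <= \sum_(i < d) expR (- (t2 * n%:R * tau / 2)) *
     (expR (t2 * deviation f [set i]%SET s) + expR (- t2 * deviation f [set i]%SET s)).
  by apply: sumr_ge0 => i _; rewrite mulr_ge0 // addr_ge0.
have V0 : 0 <= \sum_(S : {set 'I_d} | (S \subset influential f tau) && (#|S| <= m)%N)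
     2 / (t1 * n%:R) ^+ 2 *
       (expR (t1 * deviation f S s) + expR (- t1 * deviation f S s)).
  apply: sumr_ge0 => i _; rewrite mulr_ge0 // ?addr_ge0 // divr_ge0 // sqr_ge0 //.
have B0 : 0 <= 2 * K / m%:R by rewrite divr_ge0 // mulr_ge0.
have [/forallP good|] := boolP [forall i,
    `|emp_coef [set i]%SET s - fcoef f [set i]%SET| <= tau / 2].
  apply: (le_trans (loss_good_event m0 tauE f01 mf fK good)).
  rewrite addrC -[leLHS]addr0; apply: lerD => //; apply: lerD => //.
  apply: ler_sum => S _; rewrite emp_coef_deviation // mulNr.
  have -> : n%:R^-1 * deviation f S s = (t1 * n%:R)^-1 * (t1 * deviation f S s).
    by field; rewrite !gt_eqF.
  rewrite exprMn exprVn [2 / _]mulrC -mulrA ler_wpM2l ?sqr_le_expR //.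
  by rewrite invr_ge0 sqr_ge0.
rewrite negb_forall => /existsP[i]; rewrite -ltNge emp_coef_deviation // => bad.
apply: (le_trans (sqnorm2_clip_le1 _ f01)).
(* Chernoff's bound in pointwise form: off the good event the loss is at most [1], and the term of
   the last sum at the deviating [i] alone is at least [1]. *)
suff h : 1 <= expR (- (t2 * n%:R * tau / 2)) *
     (expR (t2 * deviation f [set i]%SET s) + expR (- t2 * deviation f [set i]%SET s)).
  apply: (le_trans h); rewrite (bigD1 i) //=.
  rewrite addrCA lerDl addr_ge0 ?addr_ge0 //.
  by apply: sumr_ge0 => j _; rewrite mulr_ge0 // addr_ge0.
rewrite -[leLHS](expR0 R); set D := deviation f _ s in bad *.
have bad' : tau / 2 * n%:R < `|D|.
  rewrite -ltr_pdivlMr //; apply: (lt_le_trans bad).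
  by rewrite normrM ger0_norm ?invr_ge0 ?(ltW nR) // mulrC.
have bad2 : t2 * n%:R * tau / 2 < t2 * `|D|.
  by rewrite (_ : _ / _ = t2 * (tau / 2 * n%:R)) ?ltr_pM2l //; field.
apply: (@le_trans _ _ (expR (- (t2 * n%:R * tau / 2)) * expR (t2 * `|D|))).
  by rewrite -expRD ler_expR; lra.
rewrite ler_wpM2l //; have [D0|D0] := leP 0 D.
  by rewrite ger0_norm // lerDl.
by rewrite ltr0_norm // mulrN -mulNr lerDr.
Qed.

End Estimator.

(** * Bounds on expectations and the risk of the estimator *)

Section MeanBound.
Context {R : realType} {dO} {Om : measurableType dO} (P : probability Om R).
Implicit Types (g h : Om -> R) (b c : R).

(** Bundles the side conditions of linearity of the integral, so that bounds on means compose along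
    the expression. *)
Definition mean_le g b := [/\ measurable_fun setT g, forall w, 0 <= g w
  & (\int[P]_w (g w)%:E <= b%:E)%E].

Lemma mean_le_cst c : 0 <= c -> mean_le (fun _ => c) c.
Proof.
move=> c0; split => //.
by rewrite integral_cst // [X in (_ * X)%E]probability_setT mule1.
Qed.

Lemma mean_leD g h b c : mean_le g b -> mean_le h c ->
  mean_le (fun w => g w + h w) (b + c).
Proof.
move=> [mg g0 gb] [mh h0 hc]; split; first exact: measurable_funD.
  by move=> w; rewrite addr_ge0.
under eq_integral do rewrite EFinD.
rewrite ge0_integralD //.
- by rewrite EFinD leeD.
- by move=> w _; rewrite lee_fin.
- exact/measurable_EFinP.
- by move=> w _; rewrite lee_fin.
- exact/measurable_EFinP.
Qed.

Lemma mean_leZ c g b : 0 <= c -> mean_le g b -> mean_le (fun w => c * g w) (c * b).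
Proof.
move=> c0 [mg g0 gb]; split; first exact: measurable_funM.
  by move=> w; rewrite mulr_ge0.
under eq_integral do rewrite EFinM.
rewrite ge0_integralZl_EFin //.
- by rewrite EFinM lee_wpmul2l ?lee_fin.
- by move=> w _; rewrite lee_fin.
- exact/measurable_EFinP.
Qed.

Lemma mean_le_sum (I : Type) (r : seq I) (Q : pred I) (g : I -> Om -> R) (b : I -> R) :
  (forall k, Q k -> mean_le (g k) (b k)) ->
  mean_le (fun w => \sum_(k <- r | Q k) g k w) (\sum_(k <- r | Q k) b k).
Proof.
move=> gb; elim: r => [|k r IH].
  by rewrite big_nil; under eq_fun do rewrite big_nil; exact: mean_le_cst.
rewrite big_cons; under eq_fun do rewrite big_cons.
by case: ifP => // Qk; apply: mean_leD => //; exact: gb.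
Qed.

Lemma expectation_le_mean g h b : measurable_fun setT g -> (forall w, 0 <= g w <= h w) ->
  mean_le h b -> ('E_P[g] <= b%:E)%E.
Proof.
move=> mg gh [mh h0 hb]; rewrite unlock; apply: (le_trans _ hb).
apply: ge0_le_integral => //.
- by move=> w _; rewrite lee_fin; have /andP[] := gh w.
- exact/measurable_EFinP.
- exact/measurable_EFinP.
- by move=> w _; rewrite lee_fin; have /andP[] := gh w.
Qed.

End MeanBound.

Section Risk.
Context {R : realType} {d n : nat} {dO} {Om : measurableType dO}.
Variables (P : probability Om R) (X : {RV P >-> n.-tuple (cube d)})
  (e : {RV P >-> n.-tuple R}).

Lemma measurable_sample (f : cube d -> R) :
  measurable_fun setT (fun w => sample f (X w) (e w)).
Proof.
apply/measurable_fun_tnthP => j.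
have mXj : measurable_fun setT (fun w => tnth (X w) j).
  exact: measurableT_comp (measurable_tnth j) (measurable_funP X).
rewrite (_ : _ \o _ =
    fun w => (tnth (X w) j, f (tnth (X w) j) + tnth (e w) j)); last first.
  by apply/funext => w; rewrite /= tnth_mktuple.
apply: measurable_fun_pair => //; apply: measurable_funD.
  have mf : measurable_fun setT f by move=> _ Y _; exact: measurable_cube.
  exact: measurableT_comp mf mXj.
exact: measurableT_comp (measurable_tnth j) (measurable_funP e).
Qed.

Lemma measurable_loss (fhat : n.-tuple (cube d * R) -> cube d -> R) (f : cube d -> R) :
  estimator R d n fhat ->
  measurable_fun setT
    (fun w => sqnorm2 (fun x => fhat (sample f (X w) (e w)) x - f x)).
Proof.
move=> mfhat; apply: measurable_funM => //; apply: measurable_sum => x.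
apply: measurable_funX; apply: measurable_funB => //.
exact: measurableT_comp (mfhat x) (measurable_sample f).
Qed.

Lemma risk_le1 (m : nat) (tau : R) (f : cube d -> R) : (forall x, 0 <= f x <= 1) ->
  (risk X e (low_degree_estimator m tau) f <= 1%:E)%E.
Proof.
move=> f01; apply: (@expectation_le_mean _ _ _ _ _ (fun _ => 1)).
- exact: measurable_loss (estimator_low_degree m tau).
- move=> w; rewrite sqnorm2_clip_le1 // andbT.
  by apply: cube_mean_ge0 => x; exact: sqr_ge0.
- exact: mean_le_cst.
Qed.

Lemma risk_low_degree (sigma : R) (m : nat) (tau K t1 t2 : R) (f : cube d -> R) :
  sampling_model sigma X e -> monotone_class K f ->
  (0 < n)%N -> (0 < m)%N -> tau = 36 ^- m -> 1 <= K ->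
  0 < t1 -> t1 <= 6^-1 -> 0 < t2 -> t2 <= 6^-1 ->
  let B := sigma ^+ 2 / 2 + 1 in
  (risk X e (low_degree_estimator m tau) f <=
   (2 * K / m%:R +
    expR 1 * (K / tau) ^+ m *
      (2 / (t1 * n%:R) ^+ 2 * (2 * expR (n%:R * (B * t1 ^+ 2)))) +
    d%:R * (expR (- (t2 * n%:R * tau / 2)) *
      (2 * expR (n%:R * (B * t2 ^+ 2)))))%:E)%E.
Proof.
move=> model [f01 mf fK] n0 m0 tauE K1 t10 t16 t20 t26.
set B := sigma ^+ 2 / 2 + 1 => /=.
pose s w := sample f (X w) (e w).
have tau0 : 0 < tau by rewrite tauE invr_gt0 exprn_gt0.
have tau1 : tau <= 1 by rewrite tauE invf_le1 ?exprn_gt0 // exprn_ege1 // ler1n.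
have mdev S : measurable_fun setT (fun w => deviation f S (s w)).
  rewrite (_ : (fun w => _) = fun w => n%:R * (emp_coef S (s w) - fcoef f S)); last first.
    apply/funext => w; rewrite emp_coef_deviation // mulrA mulfV ?mul1r //.
    by rewrite pnatr_eq0 -lt0n.
  apply: measurable_funM => //; apply: measurable_funB => //.
  exact: measurableT_comp (measurable_emp_coef S) (measurable_sample f).
have mgf S t : `|t| <= 6^-1 ->
    mean_le P (fun w => expR (t * deviation f S (s w))) (expR (n%:R * (B * t ^+ 2))).
  move=> t6; split.
  - by apply: measurableT_comp => //; exact: measurable_funM.
  - by move=> w; exact: expR_ge0.
  - exact: deviation_mgf.
have mgf2 S t : 0 < t -> t <= 6^-1 ->
    mean_le P (fun w => expR (t * deviation f S (s w)) + expR (- t * deviation f S (s w)))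
      (2 * expR (n%:R * (B * t ^+ 2))).
  move=> t0 t6; rewrite mulr_natl mulr2n; apply: mean_leD.
    by apply: mgf; rewrite gtr0_norm.
  by rewrite -[t ^+ 2]sqrrN; apply: mgf; rewrite normrN gtr0_norm.
pose g w := 2 * K / m%:R +
  \sum_(S : {set 'I_d} | (S \subset influential f tau) && (#|S| <= m)%N)
     2 / (t1 * n%:R) ^+ 2 *
       (expR (t1 * deviation f S (s w)) + expR (- t1 * deviation f S (s w))) +
  \sum_(i < d) expR (- (t2 * n%:R * tau / 2)) *
     (expR (t2 * deviation f [set i]%SET (s w)) +
      expR (- t2 * deviation f [set i]%SET (s w))).
have c0 : 0 <= 2 / (t1 * n%:R) ^+ 2 by rewrite divr_ge0 // sqr_ge0.
apply: (@expectation_le_mean _ _ _ _ _ g).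
- exact: measurable_loss (estimator_low_degree m tau).
- move=> w; apply/andP; split; first by apply: cube_mean_ge0 => x; exact: sqr_ge0.
  exact: loss_exponential.
have : mean_le P g (2 * K / m%:R +
  \sum_(S : {set 'I_d} | (S \subset influential f tau) && (#|S| <= m)%N)
     2 / (t1 * n%:R) ^+ 2 * (2 * expR (n%:R * (B * t1 ^+ 2))) +
  \sum_(i < d) expR (- (t2 * n%:R * tau / 2)) * (2 * expR (n%:R * (B * t2 ^+ 2)))).
  apply: mean_leD; first apply: mean_leD.
  - by apply: mean_le_cst; rewrite divr_ge0 // mulr_ge0 // (le_trans ler01).
  - by apply: mean_le_sum => S _; apply: mean_leZ => //; exact: mgf2.
  - by apply: mean_le_sum => i _; apply: mean_leZ; [exact: expR_ge0|exact: mgf2].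
move=> [mg g0 gb]; split => //; apply: (le_trans gb).
rewrite lee_fin; apply: lerD; last first.
  by rewrite sumr_const card_ord -[leLHS]mulr_natl.
apply: lerD => //.
rewrite -[X in \sum_(S | _) X]mul1r -mulr_suml ler_wpM2r ?mulr_ge0 ?expR_ge0 //.
  by rewrite invr_ge0 sqr_ge0.
exact: card_influential_sets.
Qed.

End Risk.

(** * Choice of the parameters *)

Section Rate.
Context {R : realType}.

(** Here [q] stands for [sqrt (ln n)], [N] for [n] and [D] for the dimension. The choice of [t1]
    makes [N * B * t1 ^ 2] the constant [B / 36], and [t2] minimizes the exponent
    [B * t ^ 2 - t * tau / 2]. *)
Lemma rate_bound (B eps q K D tau : R) (m : nat) :
  1 <= B -> 0 < eps -> eps < 1 -> 64 * B / eps <= q -> 1 <= K -> K <= q ->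
  m = Num.truncn (q / 8) -> tau = 36 ^- m ->
  0 <= D -> D <= expR (expR ((1 - eps) * q ^+ 2)) ->
  let N := expR (q ^+ 2) in
  let t1 := expR (- (q ^+ 2 / 2)) / 6 in
  let t2 := tau / (4 * B) in
  2 * K / m%:R +
    expR 1 * (K / tau) ^+ m *
      (2 / (t1 * N) ^+ 2 * (2 * expR (N * (B * t1 ^+ 2)))) +
    D * (expR (- (t2 * N * tau / 2)) * (2 * expR (N * (B * t2 ^+ 2)))) <=
  (32 + 144 * expR (1 + B / 36) + 2 / (1 - eps)) * (K / q).
Proof.
move=> B1 e0 e1 qB K1 Kq mE tauE D0 DU /=.
set N := expR (q ^+ 2); set t1 := expR (- (q ^+ 2 / 2)) / 6.
set t2 := tau / (4 * B).
have ex0 := @expR_gt0 R.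
have B0 : 0 < B by lra.
have q64 : 64 <= q.
  apply: le_trans qB; rewrite ler_pdivlMr //; nra.
have q0 : 0 < q by lra.
have Kq0 : 0 < K / q by rewrite divr_gt0 // (lt_le_trans ltr01).
have [m1 m2] : m%:R <= q / 8 /\ q / 8 < m%:R + 1.
  have q80 : 0 <= q / 8 by rewrite divr_ge0 // ltW.
  by have /andP[] := truncn_itv q80; rewrite -mE -[m.+1%:R]natr1.
have m0 : 0 < m%:R :> R by lra.
have N0 : 0 < N by exact: ex0.
(* Together with [m <= q / 8] this gives [tau^-1 <= expR q]; the divisor 8 in [m] is chosen for
   it. *)
have e36 : 36 <= expR 8 :> R.
  have -> : expR 8 = expR 1 ^+ 8 :> R by rewrite -expRM_natl mulr1.
  have h2 : 2 <= expR 1 :> R by have := expR_ge1Dx (1 : R); lra.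
  apply: (@le_trans _ _ (2 ^+ 8)); last by rewrite lerXn2r ?nnegrE ?(ltW (ex0 _)).
  by rewrite -natrX ler_nat.
have tau0 : 0 < tau by rewrite tauE invr_gt0 exprn_gt0.
have tauV : tau^-1 <= expR q.
  rewrite tauE invrK (le_trans (_ : _ <= expR 8 ^+ m)) //.
    by rewrite lerXn2r ?nnegrE ?(ltW (ex0 _)).
  by rewrite -expRM_natl ler_expR; lra.
have q_expq : q <= expR q by have := expR_ge1Dx q; lra.
rewrite [leRHS]mulrDl [X in _ <= X + _]mulrDl; apply: lerD; first apply: lerD.
- rewrite (_ : 32 * (K / q) = 2 * K * (16 / q)); last by field; lra.
  rewrite ler_pM2l; last by lra.
  rewrite -[leLHS]mul1r ler_pdivrMr // mulrAC ler_pdivlMr //; lra.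
- have -> : N * (B * t1 ^+ 2) = B / 36.
    rewrite /N /t1 expr_div_n -expRM_natl.
    have -> : expR (2%:R * - (q ^+ 2 / 2)) = (expR (q ^+ 2))^-1.
      by rewrite -expRN; congr expR; field.
    by field; rewrite gt_eqF.
  have -> : (t1 * N) ^+ 2 = N / 36.
    rewrite /t1 exprMn expr_div_n -expRM_natl.
    have -> : expR (2%:R * - (q ^+ 2 / 2)) = N^-1.
      by rewrite /N -expRN; congr expR; field.
    by field; rewrite gt_eqF.
  have -> : expR 1 * (K / tau) ^+ m * (2 / (N / 36) * (2 * expR (B / 36))) =
      144 * expR (1 + B / 36) * ((K / tau) ^+ m / N).
    by rewrite expRD; field; rewrite !gt_eqF.
  rewrite ler_pM2l ?mulr_gt0 //.
  apply: (@le_trans _ _ (1 / q)); last by rewrite ler_pM2r ?invr_gt0.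
  rewrite ler_pdivrMr // mul1r [leRHS]mulrC ler_pdivlMr //.
  have KT : K / tau <= expR (2 * q).
    rewrite (_ : 2 * q = q + q) ?expRD; last by ring.
    apply: ler_pM => //; [lra | by rewrite invr_ge0 ltW | exact: le_trans q_expq].
  (* As [m <= q / 8], the power is at most [expR (q ^ 2 / 4)], which leaves room in
     [N = expR (q ^ 2)] for the factor [expR q]. *)
  apply: (@le_trans _ _ (expR (2 * q) ^+ m * expR q)).
    have KT0 : 0 <= K / tau by rewrite divr_ge0 ?(ltW tau0) //; lra.
    apply: ler_pM; rewrite ?exprn_ge0 ?(ltW q0) //.
    by rewrite lerXn2r ?nnegrE ?(ltW (ex0 _)).
  rewrite -expRM_natl -expRD ler_expR.
  by nra.
have expo : - (t2 * N * tau / 2) + N * (B * t2 ^+ 2) = - (N * tau ^+ 2 / (16 * B)).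
  by rewrite /t2; field; rewrite gt_eqF.
set U := expR ((1 - eps) * q ^+ 2) in DU.
have U0 : 0 < U by exact: ex0.
(* The Chernoff exponent beats [ln D <= U] twice over: [N * tau ^ 2] exceeds [U] by the factor
   [expR (eps * q ^ 2 - 2 * q)], and [q >= 64 * B / eps] makes that at least [32 * B]. One [U]
   absorbs [D], the other is the decay. *)
have key : 2 * U <= N * tau ^+ 2 / (16 * B).
  rewrite ler_pdivlMr; last by lra.
  have t2q : expR (- (2 * q)) <= tau ^+ 2.
    rewrite -[tau]invrK exprVn expRN lef_pV2 ?posrE ?exprn_gt0 ?invr_gt0 //.
    by rewrite expRM_natl lerXn2r ?nnegrE ?invr_ge0 ?(ltW (ex0 _)) ?(ltW tau0).
  apply: (@le_trans _ _ (N * expR (- (2 * q)))); last by rewrite ler_pM2l.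
  have -> : N * expR (- (2 * q)) = U * expR (eps * q ^+ 2 - 2 * q).
    by rewrite /N /U -!expRD; congr expR; ring.
  rewrite (_ : 2 * U * (16 * B) = U * (32 * B)); last by ring.
  rewrite ler_pM2l // (le_trans _ (expR_ge1Dx _)) //.
  have qe : 64 * B <= q * eps by rewrite -ler_pdivrMr.
  by nra.
apply: (@le_trans _ _ (2 * expR (- U))).
  have -> : D * (expR (- (t2 * N * tau / 2)) * (2 * expR (N * (B * t2 ^+ 2)))) =
      2 * (D * expR (- (N * tau ^+ 2 / (16 * B)))).
    by rewrite -expo expRD; ring.
  rewrite ler_pM2l // (_ : - U = U + - (2 * U)); last by ring.
  by rewrite expRD; apply: ler_pM; rewrite ?(ltW (ex0 _)) ?ler_expR ?lerN2.
rewrite -mulrA ler_pM2l //.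
apply: (@le_trans _ _ ((1 - eps)^-1 * (1 / q))); last first.
  by rewrite ler_pM2l ?ler_pM2r ?invr_gt0 // subr_gt0.
rewrite mul1r -invfM expRN lef_pV2 ?posrE ?mulr_gt0 // ?subr_gt0 //.
have h1 := expR_ge1Dx U; have h2 := expR_ge1Dx ((1 - eps) * q ^+ 2).
rewrite -/U in h2.
have : (1 - eps) * q <= (1 - eps) * q ^+ 2.
  rewrite ler_pM2l ?subr_gt0 // expr2 ler_peMl //; lra.
by lra.
Qed.

End Rate.

Lemma upper_bound (R : realType) (sigma eps : R) : 0 < eps -> eps < 1 ->
  exists2 C : R, 0 < C & forall n d : nat, (2 <= n)%N -> (1 <= d)%N ->
    ln (d%:R : R) <= n%:R `^ (1 - eps) ->
    exists fhat : n.-tuple (cube d * R) -> cube d -> R,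
      estimator R d n fhat /\
      forall K : R, 1 <= K ->
      forall (dO : measure_display) (Om : measurableType dO)
        (P : probability Om R) (X : {RV P >-> n.-tuple (cube d)})
        (e : {RV P >-> n.-tuple R}),
        sampling_model sigma X e ->
        (ereal_sup [set risk X e fhat f | f in monotone_class K]
           <= (C * (K / Num.sqrt (ln (n%:R : R))))%:E)%E.
Proof.
move=> e0 e1; pose B := sigma ^+ 2 / 2 + 1; pose q0 := 64 * B / eps.
have B1 : 1 <= B by rewrite /B lerDr divr_ge0 // sqr_ge0.
have B0 : 0 < B by exact: lt_le_trans B1.
have q0_ge : 64 <= q0 by rewrite /q0 ler_pdivlMr //; nra.
pose C1 := 32 + 144 * expR (1 + B / 36) + 2 / (1 - eps).
have C1ge : 32 <= C1.
  have := expR_gt0 (1 + B / 36).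
  have : 0 <= 2 / (1 - eps) by rewrite divr_ge0 // subr_ge0 ltW.
  by rewrite /C1; lra.
exists (q0 + C1); first by lra.
move=> n d n2 d1 hd; set q := Num.sqrt (ln (n%:R : R)).
have n0 : (0 < n)%N by exact: ltn_trans n2.
have nR : 0 < n%:R :> R by rewrite ltr0n.
have L0 : 0 < ln (n%:R : R) by rewrite ln_gt0 // ltr1n.
have q_gt0 : 0 < q by rewrite sqrtr_gt0.
have q2 : q ^+ 2 = ln n%:R by rewrite sqr_sqrtr // ltW.
pose m := Num.truncn (q / 8); pose tau : R := 36 ^- m.
exists (low_degree_estimator m tau); split; first exact: estimator_low_degree.
move=> K K1 dO Om P X e model; apply: ge_ereal_sup => _ [f fK <-].
have Kq0 : 0 < K / q by rewrite divr_gt0 // (lt_le_trans ltr01).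
have f01 : forall x, 0 <= f x <= 1 by have [] := fK.
(* If [n] is bounded in terms of [sigma] and [eps], or if [K] exceeds [q], the claimed bound is at
   least [1] and clipping suffices; the summand [q0] of the constant covers the first case. *)
have [big|] := boolP ((q0 <= q) && (K <= q)); last first.
  move=> small; apply: (le_trans (risk_le1 _ _ _ _ f01)); rewrite lee_fin.
  move: small; rewrite negb_and -!ltNge => /orP[qq0|qK].
    apply: (@le_trans _ _ (q * (1 / q))); first by rewrite mul1r mulfV // gt_eqF.
    apply: ler_pM => //; [exact: ltW|by rewrite divr_ge0 // ltW|lra|].
    by rewrite ler_pM2r // invr_gt0.
  rewrite -[1]mulr1; apply: ler_pM => //; first by lra.
  by rewrite ler_pdivlMr // mul1r ltW.
move: big => /andP[qq0 Kq].
have m0 : (0 < m)%N by rewrite truncn_gt0 ler_pdivlMr //; lra.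
have tau0 : 0 < tau by rewrite invr_gt0 exprn_gt0.
have tau36 : tau <= 36^-1.
  by rewrite lef_pV2 ?posrE ?exprn_gt0 // ler_eXnr // ler1n.
have NE : expR (q ^+ 2) = n%:R by rewrite q2 lnK.
pose t1 : R := expR (- (q ^+ 2 / 2)) / 6; pose t2 := tau / (4 * B).
have t10 : 0 < t1 by rewrite divr_gt0 // expR_gt0.
have t16 : t1 <= 6^-1.
  rewrite ler_piMl // -[leRHS]expR0 ler_expR oppr_le0 divr_ge0 // sqr_ge0 //.
have t20 : 0 < t2 by rewrite divr_gt0 // mulr_gt0.
have t26 : t2 <= 6^-1 by rewrite ler_pdivrMr ?mulr_gt0 //; lra.
apply: (le_trans (risk_low_degree model fK n0 m0 erefl K1 t10 t16 t20 t26)).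
rewrite lee_fin -/B.
have Dd : d%:R <= expR (expR ((1 - eps) * q ^+ 2)).
  rewrite -[leLHS]lnK ?posrE ?ltr0n // ler_expR (le_trans hd) //.
  by rewrite /powR gt_eqF // q2.
have := rate_bound B1 e0 e1 qq0 K1 Kq erefl erefl (ler0n _ d) Dd.
rewrite /= -/m -/tau -/t1 -/t2 NE => /le_trans; apply.
by rewrite ler_pM2r // /C1; lra.
Qed.

(** * The hard family *)

Lemma bin_central_rec (k : nat) :
  (k.+1 * 'C(k.+1.*2, k.+1) = 2 * (k.*2.+1 * 'C(k.*2, k)))%N.
Proof.
have -> : 'C(k.*2, k) = 'C(k.*2.+1.-1, k) by [].
rewrite mul_bin_diag doubleS binS mulnDr.
have -> : 'C(k.*2.+1, k) = 'C(k.*2.+1, k.+1).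
  by rewrite -[RHS]bin_sub; [congr 'C(_, _); lia|lia].
by rewrite mul2n addnn.
Qed.

(** Squaring gives [16 ^ k <= 4 * k * 'C(k.*2, k) ^ 2], an induction in the integers whose step is
    [4 * (k + 1) * (k + 2) <= (2 * k + 3) ^ 2]. *)
Lemma central_binomial_ge (R : rcfType) (k : nat) : (0 < k)%N ->
  4 ^+ k <= 2 * Num.sqrt k%:R * 'C(k.*2, k)%:R :> R.
Proof.
move=> k0.
have H : (16 ^ k <= 4 * k * 'C(k.*2, k) ^ 2)%N.
  elim: k k0 => // -[|k] IH _ //.
  move: (IH isT) (bin_central_rec k.+1).
  set c := 'C(k.+1.*2, k.+1); set c' := 'C(k.+2.*2, k.+2) => {}IH rec.
  rewrite -(leq_pmul2l (ltn0Sn k.+1)) expnS.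
  have -> : (k.+2 * (4 * k.+2 * c' ^ 2) = 4 * (k.+2 * c') ^ 2)%N by lia.
  rewrite rec.
  have -> : (4 * (2 * (k.+1.*2.+1 * c)) ^ 2 = 16 * (k.+1.*2.+1 ^ 2 * c ^ 2))%N by lia.
  apply: (@leq_trans (k.+2 * (16 * (4 * k.+1 * c ^ 2)))).
    by rewrite leq_pmul2l // leq_pmul2l.
  have -> : (k.+2 * (16 * (4 * k.+1 * c ^ 2)) = 16 * ((4 * k.+1 * k.+2) * c ^ 2))%N by lia.
  rewrite leq_pmul2l // leq_mul2r; apply/orP; right; lia.
rewrite -ler_sqr ?nnegrE ?mulr_ge0 ?exprn_ge0 ?sqrtr_ge0 //.
rewrite !exprMn sqr_sqrtr // -exprM mulnC exprM.
by rewrite -!natrX -!natrM ler_nat.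
Qed.

Section HardFamily.
Context {R : realType} {d : nat}.
Variables (m : nat) (hmd : (m <= d)%N).
Implicit Types (x y : cube d) (theta : {ffun cube d -> bool}).

Definition weight x : nat := \sum_(i < d) ((i < m)%N && tnth x i).

(* Zeroing the irrelevant coordinates represents the projection of the cube
   onto its first [m] coordinates without leaving [cube d]. *)
Definition head_part x : cube d := [tuple (i < m)%N && tnth x i | i < d].

Definition hard_fun (k : nat) (a : R) theta x : R :=
  if (weight x < k)%N then 0
  else if weight x == k then (if theta (head_part x) then a else 0) else a.

Lemma hard_fun_bounds k a theta x : 0 <= a -> 0 <= hard_fun k a theta x <= a.
Proof.
by move=> a0; rewrite /hard_fun; do 3?case: ifP => _; rewrite ?lexx ?a0.
Qed.

(** Comparable points of equal weight have the same head part: equality of the sums forces equality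
    of each term. Labels on a single layer are therefore unconstrained. *)
Lemma hard_fun_monotone k a theta : 0 <= a -> cube_monotone (hard_fun k a theta).
Proof.
move=> a0 x y xy.
have le (i : 'I_d) : ((i < m)%N && tnth x i <= (i < m)%N && tnth y i)%N.
  by have := xy i; case: (_ < m)%N => //=; case: (tnth x i); case: (tnth y i).
have [wxy wE] := leqif_sum (fun (i : 'I_d) (_ : true) => leqif_eq (le i)).
have [wlt|wyx] := ltnP (weight x) (weight y).
  rewrite {2}/hard_fun; case: ifPn => [h|_].
    by rewrite /hard_fun (ltn_trans wlt h).
  case: eqP => [wyk|_]; last by have /andP[] := hard_fun_bounds k theta x a0.
  by rewrite /hard_fun -wyk wlt; case: ifP.
have weq : weight x = weight y by apply/eqP; rewrite eqn_leq wxy.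
have hxy : head_part x = head_part y.
  apply: eq_from_tnth => i; rewrite !tnth_mktuple.
  have : weight x == weight y by rewrite weq.
  rewrite [_ == _]wE => /forallP/(_ i) /=.
  by do 2 case: (_ && _).
by rewrite /hard_fun weq hxy.
Qed.

Lemma hard_fun_irrelevant k a theta (i : 'I_d) x b :
  i \notin [set i : 'I_d | (i < m)%N]%SET ->
  hard_fun k a theta (set_coord x i b) = hard_fun k a theta x.
Proof.
rewrite finset.inE => im.
have E (j : 'I_d) : (j < m)%N && tnth (set_coord x i b) j = (j < m)%N && tnth x j.
  rewrite tnth_set_coord; have [->|//] := eqVneq j i.
  by rewrite (negbTE im).
have wE : weight (set_coord x i b) = weight x by apply: eq_bigr => j _; rewrite E.
have hE : head_part (set_coord x i b) = head_part x.
  by apply: eq_from_tnth => j; rewrite [LHS]tnth_mktuple [RHS]tnth_mktuple E.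
by rewrite /hard_fun wE hE.
Qed.

Lemma card_head : #|[set i : 'I_d | (i < m)%N]%SET| = m.
Proof.
rewrite -sum1_card (eq_bigl (fun i : 'I_d => (i < m)%N)); last first.
  by move=> i; rewrite finset.inE.
by rewrite (big_ord_narrow hmd) sum1_card card_ord.
Qed.

Lemma prod_head (T : comNzRingType) (u v : T) :
  \prod_(i < d) (if (i < m)%N then u else v) = u ^+ m * v ^+ (d - m).
Proof.
rewrite (bigID (fun i : 'I_d => (i < m)%N)) /=; congr (_ * _).
  rewrite (eq_bigr (fun _ => u)) => [|i ->//].
  by rewrite (big_ord_narrow hmd) prodr_const card_ord.
rewrite (eq_bigr (fun _ => v)) => [|i /negbTE ->//].
rewrite prodr_const; congr (_ ^+ _).
have <- : #|(~: [set i : 'I_d | (i < m)%N])%SET| = (d - m)%N.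
  by rewrite cardsCs finset.setCK card_head card_ord.
by apply: eq_card => i; rewrite !finset.inE.
Qed.

(** The generating polynomial of the weight is [(1 + 'X) ^ m * 2 ^ (d - m)]; the claim is its
    coefficient of degree [k]. *)
Lemma cube_mean_weight k :
  cube_mean (fun x => (weight x == k)%:R) = 'C(m, k)%:R / 2 ^+ m :> R.
Proof.
have E : \sum_(x : cube d) 'X^(weight x) = (1 + 'X) ^+ m * 2 ^+ (d - m) :> {poly R}.
  rewrite -prod_head.
  pose F (i : 'I_d) (b : bool) : {poly R} := if (i < m)%N && b then 'X else 1.
  transitivity (\sum_(x : cube d) \prod_(i < d) F i (tnth x i)).
    apply: eq_bigr => x _; rewrite /weight -prodrXr; apply: eq_bigr => i _.
    by rewrite /F; case: (_ && _).
  rewrite (sum_tuple_prod F).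
  apply: eq_bigr => i _; rewrite big_bool /F andbT andbF.
  by case: ifP => _; [rewrite addrC|].
have {}E : \sum_(x : cube d) (weight x == k)%:R = 'C(m, k)%:R * 2 ^+ (d - m) :> R.
  transitivity ((\sum_(x : cube d) 'X^(weight x) : {poly R})`_k).
    by rewrite coef_sum; apply: eq_bigr => x _; rewrite coefXn eq_sym.
  rewrite E -[2]/(2%:R) -natrX mulr_natr coefMn.
  have -> : ((1 + 'X) ^+ m : {poly R})`_k = 'C(m, k)%:R.
    rewrite exprDn coef_sum.
    have [km|mk] := leqP k m.
      rewrite (bigD1 (Ordinal (km : (k < m.+1)%N))) //= expr1n mul1r coefMn coefXn eqxx.
      rewrite big1 ?addr0 // => i ik; rewrite expr1n mul1r coefMn coefXn.
      case: eqP => [ki|]; last by rewrite mul0rn.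
      by move: ik; rewrite -val_eqE /= -ki eqxx.
    rewrite bin_small // big1 // => i _; rewrite expr1n mul1r coefMn coefXn.
    case: eqP => [ki|]; last by rewrite mul0rn.
    by have := ltn_ord i; rewrite -ki ltnS leqNgt mk.
  by rewrite -[LHS]mulr_natr natrX.
rewrite /cube_mean E -{1}(subnK hmd) exprD; field.
by rewrite !expf_neq0.
Qed.

Lemma cube_mean_head x :
  cube_mean (fun y => (head_part y == head_part x)%:R) = 2 ^- m :> R.
Proof.
pose F (i : 'I_d) (b : bool) : R := if (i < m)%N then (b == tnth x i)%:R else 1.
rewrite (@eq_cube_mean _ _ _ (fun y => \prod_i F i (tnth y i))).
  transitivity (\prod_(i < d) (if (i < m)%N then 2^-1 else 1 : R)); last first.
    by rewrite prod_head expr1n mulr1 exprVn.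
  rewrite cube_mean_prod.
  apply: eq_bigr => i _; rewrite /F; case: ifP => _; last by field.
  by case: (tnth x i); rewrite /= ?addr0 ?add0r mul1r.
move=> y; rewrite /F; case: eqP => [yx|yx].
  rewrite big1 // => i _; case: ifP => // im.
  have := congr1 (fun t => tnth t i) yx.
  by rewrite !tnth_mktuple im /= => ->; rewrite eqxx.
have [i yxi] : exists i : 'I_d, ~~ (((i < m)%N && tnth y i) == ((i < m)%N && tnth x i)).
  apply/existsP; rewrite -negb_forall; apply/negP => /forallP H; apply: yx.
  by apply: eq_from_tnth => i; rewrite !tnth_mktuple; apply/eqP.
rewrite (bigD1 i) //=; move: yxi; case: (_ < m)%N => //=.
by move=> /negbTE ->; rewrite mul0r.
Qed.

End HardFamily.

(** * Averaging over designs and labels *)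

Section DesignMean.
Context {R : realType} {d n : nat}.

Definition design_mean (g : n.-tuple (cube d) -> R) : R :=
  (2 ^+ d)^-1 ^+ n * \sum_(x : n.-tuple (cube d)) g x.

Lemma ler_design_mean g h : (forall x, g x <= h x) -> design_mean g <= design_mean h.
Proof.
move=> gh; rewrite /design_mean ler_wpM2l ?exprn_ge0 ?invr_ge0 ?exprn_ge0 //.
exact: ler_sum.
Qed.

Lemma design_meanZ c g : design_mean (fun x => c * g x) = c * design_mean g.
Proof. by rewrite /design_mean -mulr_sumr mulrCA. Qed.

Lemma design_mean_sum (I : finType) (g : I -> n.-tuple (cube d) -> R) :
  design_mean (fun x => \sum_k g k x) = \sum_k design_mean (g k).
Proof. by rewrite /design_mean exchange_big mulr_sumr. Qed.

Lemma design_mean_prod (F : 'I_n -> cube d -> R) :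
  design_mean (fun x => \prod_j F j (tnth x j)) = \prod_j cube_mean (F j).
Proof.
by rewrite /design_mean sum_tuple_prod big_split /= prodr_const card_ord.
Qed.

Lemma bernoulli_ineq (u : R) k : 0 <= u <= 1 -> 1 - k%:R * u <= (1 - u) ^+ k.
Proof.
move=> /andP[u0 u1]; elim: k => [|k IH]; first by rewrite mul0r subr0 expr0.
rewrite exprS -[k.+1%:R]natr1.
have := ler_wpM2l (_ : 0 <= 1 - u) IH; rewrite subr_ge0 => /(_ u1).
apply: le_trans; have h : 0 <= k%:R * u * u by rewrite !mulr_ge0.
lra.
Qed.

Section Average.
Variables (m k : nat) (hmd : (m <= d)%N) (a : R).
Variables (fhat : n.-tuple (cube d * R) -> cube d -> R) (z : n.-tuple R).

Definition unseen (x : cube d) (X : n.-tuple (cube d)) : bool :=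
  [forall j, head_part m (tnth X j) != head_part m x].

(** Each design point hits the head part of [x] with probability [2 ^- m], so Bernoulli's inequality
    leaves at least [1 - n * 2 ^- m >= 1/2]. *)
Lemma design_mean_unseen x : (2 * n <= 2 ^ m)%N ->
  2^-1 <= design_mean (fun X => (unseen x X)%:R).
Proof.
move=> nm.
pose g (y : cube d) : R := (head_part m y != head_part m x)%:R.
have -> : design_mean (fun X => (unseen x X)%:R) =
    design_mean (fun X => \prod_j g (tnth X j)).
  congr (_ * _); apply: eq_bigr => X _; rewrite /unseen.
  have [/forallP H|] := boolP [forall j, head_part m (tnth X j) != head_part m x].
    by rewrite big1 // => j _; rewrite /g H.
  by rewrite negb_forall => /existsP[j /negbTE H]; rewrite (bigD1 j) //= /g H mul0r.
rewrite (design_mean_prod (fun _ => g)) prodr_const card_ord.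
have -> : cube_mean g = 1 - 2 ^- m.
  rewrite -(cube_mean_head hmd x) -[X in _ = X - _](@cube_mean_cst R d) -cube_meanB.
  by apply: eq_cube_mean => y; rewrite /g; case: eqP; rewrite ?subrr ?subr0.
have p0 : 0 < 2 ^+ m :> R by rewrite exprn_gt0.
apply: (le_trans _ (bernoulli_ineq _ _)).
  have : n%:R * 2 ^- m <= 2^-1 :> R.
    rewrite ler_pdivrMr // mulrC ler_pdivlMr //.
    by rewrite -natrX -natrM ler_nat mulnC.
  by lra.
by rewrite invr_ge0 ltW //= invf_le1 // exprn_ege1 // ler1n.
Qed.

Definition flip_label (x : cube d) (theta : {ffun cube d -> bool}) :
    {ffun cube d -> bool} :=
  [ffun y => (y == head_part m x) (+) theta y].

Lemma flip_labelK x : involutive (flip_label x).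
Proof. by move=> theta; apply/ffunP => y; rewrite !ffunE addKb. Qed.

Lemma sample_flip_label x X theta : unseen x X ->
  sample (hard_fun m k a (flip_label x theta)) X z =
  sample (hard_fun m k a theta) X z.
Proof.
move=> /forallP U; apply: eq_from_tnth => j; rewrite !tnth_mktuple.
by rewrite /hard_fun ffunE (negbTE (U j)).
Qed.

(* An unobserved label is invisible in the sample, so the estimator predicts the
   same value for [theta] and for its flip, and errs by [a / 2] on one of them. *)
Lemma sum_labels_error x X : weight m x = k -> unseen x X ->
  #|{ffun cube d -> bool}|%:R * (a ^+ 2 / 4) <=
  \sum_theta (fhat (sample (hard_fun m k a theta) X z) x - hard_fun m k a theta x) ^+ 2.
Proof.
move=> wx ux; pose G theta :=
  (fhat (sample (hard_fun m k a theta) X z) x - hard_fun m k a theta x) ^+ 2.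
rewrite -/(G _).
have E : \sum_theta G theta = \sum_theta G (flip_label x theta).
  by rewrite (reindex_inj (inv_inj (flip_labelK x))).
suff : #|{ffun cube d -> bool}|%:R * (a ^+ 2 / 2) <=
    \sum_theta (G theta + G (flip_label x theta)).
  by rewrite big_split /= -E => h; lra.
rewrite mulr_natl -sumr_const; apply: ler_sum => theta _.
rewrite /G sample_flip_label // /hard_fun wx ltnn eqxx ffunE eqxx /=.
set h := fhat _ _; case: (theta _) => /=; rewrite -subr_ge0.
  rewrite (_ : _ - _ = 2 * (h - a / 2) ^+ 2); last by field.
  by rewrite mulr_ge0 // sqr_ge0.
rewrite (_ : _ - _ = 2 * (h - a / 2) ^+ 2); last by field.
by rewrite mulr_ge0 // sqr_ge0.
Qed.

(** After exchanging the averages, each [x] of the layer contributes [a ^ 2 / 4] from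
    [sum_labels_error] times [1/2], the chance of being unseen; the last factor is the mass of the
    layer. *)
Lemma average_risk : (2 * n <= 2 ^ m)%N ->
  #|{ffun cube d -> bool}|%:R * (a ^+ 2 / 8 * ('C(m, k)%:R / 2 ^+ m)) <=
  \sum_theta design_mean (fun X => sqnorm2 (fun x =>
    fhat (sample (hard_fun m k a theta) X z) x - hard_fun m k a theta x)).
Proof.
move=> nm; rewrite -design_mean_sum.
pose N : R := #|{ffun cube d -> bool}|%:R.
pose G x X := \sum_theta
  (fhat (sample (hard_fun m k a theta) X z) x - hard_fun m k a theta x) ^+ 2.
have -> : design_mean (fun X => \sum_theta sqnorm2 (fun x =>
    fhat (sample (hard_fun m k a theta) X z) x - hard_fun m k a theta x)) =
    cube_mean (fun x => design_mean (G x)).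
  rewrite /design_mean cube_meanZ cube_mean_sum; congr (_ * _).
  by apply: eq_bigr => X _; rewrite cube_mean_sum.
rewrite -(cube_mean_weight hmd) mulrA -cube_meanZ; apply: ler_cube_mean => x.
have [wx|_] := eqVneq; last first.
  rewrite mulr0 /design_mean mulr_ge0 ?exprn_ge0 ?invr_ge0 ?exprn_ge0 //.
  by apply: sumr_ge0 => X _; apply: sumr_ge0 => theta _; exact: sqr_ge0.
apply: (@le_trans _ _ (design_mean (fun X => N * (a ^+ 2 / 4) * (unseen x X)%:R))).
  rewrite design_meanZ mulr1.
  rewrite (_ : _ * (a ^+ 2 / 8) = N * (a ^+ 2 / 4) * 2^-1); last by rewrite /N; field.
  rewrite ler_wpM2l ?design_mean_unseen //.
  by rewrite mulr_ge0 ?divr_ge0 ?sqr_ge0.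
apply: ler_design_mean => X.
have [ux|_] := boolP (unseen x X); first by rewrite mulr1; exact: sum_labels_error.
by rewrite mulr0; apply: sumr_ge0 => theta _; exact: sqr_ge0.
Qed.

End Average.

End DesignMean.

(** * Noiseless sampling from the uniform design *)

Section UniformDesign.
Context {R : realType} {d n : nat}.

Local Notation design := (n.-tuple (cube d)).

Let design_mass_ge0 : 0 <= (2 ^+ d)^-1 ^+ n :> R.
Proof. by rewrite exprn_ge0 // invr_ge0 exprn_ge0. Qed.

(** A default for [nth]; the indices in use stay below the number of designs. *)
Let design0 : design := [tuple [tuple false | _ < d] | _ < n].

(** Built from Dirac masses, so that the measure structure comes from the constructors and integrals
    become finite sums. *)
Definition uniform_design : set design -> \bar R :=
  mscale (NngNum design_mass_ge0)
    (msum (fun i => dirac (nth design0 (enum {: design}) i)) #|{: design}|).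

HB.instance Definition _ := Measure.on uniform_design.

Lemma integral_uniform_design (g : design -> R) : (forall x, 0 <= g x) ->
  (\int[uniform_design]_x (g x)%:E = (design_mean g)%:E)%E.
Proof.
move=> g0; have mg : measurable_fun setT (fun x => (g x)%:E).
  by move=> _ Y _; rewrite setTI; exact: measurable_design.
rewrite ge0_integral_mscale //; last by move=> x _; rewrite lee_fin.
rewrite ge0_integral_measure_sum //; last by move=> x _; rewrite lee_fin.
rewrite /design_mean EFinM; congr (_ * _)%E; rewrite -sumEFin.
rewrite -[RHS]big_enum (big_nth design0) big_mkord -cardE.
apply: eq_bigr => i _; rewrite integral_dirac //.
by rewrite diracE in_setT mul1e.
Qed.

Lemma uniform_designE (A : set design) :
  (uniform_design A = (design_mean \1_A)%:E)%E.
Proof.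
rewrite -integral_uniform_design // integral_indic ?setIT //.
exact: measurable_design.
Qed.

Lemma design_mean_cst (c : R) : design_mean (fun _ : design => c) = c.
Proof.
rewrite /design_mean sumr_const card_tuple -(mulr_natl c) natrX.
by rewrite [X in X ^+ n * c]card_cube mulrA -exprMn mulVf ?expr1n ?mul1r.
Qed.

Let uniform_design_setT : uniform_design setT = 1%E.
Proof.
rewrite uniform_designE (_ : \1_setT = fun _ => 1) ?design_mean_cst //.
by apply/funext => x; rewrite indicE in_setT.
Qed.

HB.instance Definition _ := Measure_isProbability.Build _ _ _
  uniform_design uniform_design_setT.

Lemma iid_uniform_design : iid_uniform (uniform_design : probability _ _).
Proof.
have marg i (A : set (cube d)) :
    uniform_design [set t : design | A (tnth t i)] = (cube_mean \1_A)%:E.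
  rewrite uniform_designE; congr (_%:E).
  pose F (j : 'I_n) (y : cube d) : R := if j == i then \1_A y else 1.
  transitivity (design_mean (fun x => \prod_j F j (tnth x j))).
    congr (_ * _); apply: eq_bigr => x _; rewrite (bigD1 i) //= /F eqxx big1 ?mulr1.
      by [].
    by move=> j /negbTE ->.
  rewrite design_mean_prod (bigD1 i) //= big1 ?mulr1.
    by apply: eq_cube_mean => y; rewrite /F eqxx.
  move=> j /negbTE ji; rewrite -[RHS](@cube_mean_cst R d).
  by apply: eq_cube_mean => y; rewrite /F ji.
split.
  move=> A mA; rewrite (eq_bigr (fun i => (cube_mean \1_(A i))%:E)); last first.
    by move=> i _; exact: marg.
  rewrite prodEFin -design_mean_prod [LHS]uniform_designE; congr (_%:E).
  congr (_ * _); apply: eq_bigr => x _; rewrite indicE.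
  have [/set_mem xA|/negP xA] := boolP (_ \in _).
    by rewrite big1 // => i _; rewrite indicE mem_set.
  have [i Ai] : exists i, ~ A i (tnth x i).
    by apply/existsNP => H; apply: xA; rewrite inE.
  by rewrite (bigD1 i) //= indicE memNset // mul0r.
move=> i x; rewrite [LHS](marg i [set x]); congr (_%:E).
rewrite /cube_mean (bigD1 x) //= big1 => [|y yx].
  by rewrite addr0 indicE mem_set // mulr1.
by rewrite indicE memNset //= => yx'; move: yx; rewrite yx' eqxx.
Qed.

End UniformDesign.

Section NoiselessModel.
Context {R : realType} {d n : nat}.

Local Notation P := (@uniform_design R d n : probability _ R).
(** The identity under a name that can carry the random variable structure: the sample space is the
    space of designs itself. *)
Definition observed_design (x : n.-tuple (cube d)) : n.-tuple (cube d) := x.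

HB.instance Definition _ :=
  @isMeasurableFun.Build _ _ _ _ observed_design (@measurable_id _ _ setT).

Local Notation X := (observed_design : {RV P >-> n.-tuple (cube d)}).

Let zero_noise : n.-tuple R := [tuple 0 | _ < n].

Local Notation e := (cst zero_noise : {RV P >-> n.-tuple R}).

Lemma noiseless_model (sigma : R) : sampling_model sigma X e.
Proof.
have PT : P setT = 1%E by exact: probability_setT.
(* A constant noise has a law with values [0] and [1], which makes independence a matter of
   cases. *)
have De A : distribution P e A = if `[< A zero_noise >] then 1%E else 0%E.
  rewrite /distribution /pushforward.
  case: asboolP => h.
    by rewrite (_ : _ @^-1` _ = setT) //; apply/seteqP; split.
  by rewrite (_ : _ @^-1` _ = set0) ?measure0 //; apply/seteqP; split.
have int_e (g : n.-tuple R -> R) : measurable_fun setT g -> (forall y, 0 <= g y) ->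
    (\int[distribution P e]_y (g y)%:E = (g zero_noise)%:E)%E.
  move=> mg g0; rewrite ge0_integral_distribution //.
  - rewrite (eq_integral (cst (g zero_noise)%:E)) // integral_cst //.
    by rewrite [X in (_ * X)%E]probability_setT mule1.
  - exact/measurable_EFinP.
split.
- exact: iid_uniform_design.
- split.
  + move=> A mA; rewrite [LHS]De.
    rewrite (eq_bigr (fun i => if `[< A i (tnth zero_noise i) >] then 1%E else 0%E));
      last by move=> i _; exact: (De [set t | A i (tnth t i)]).
    case: asboolP => /= h; first by rewrite big1 // => i _; rewrite asboolT.
    have [i Ai] : exists i, ~ A i (tnth zero_noise i) by apply/existsNP.
    by rewrite (bigD1 i) //= asboolF // mul0e.
  + move=> i; rewrite unlock integral_pushforward //.
    * rewrite (eq_integral (cst 0%E)) ?integral0 // => w _ /=.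
      by rewrite tnth_mktuple.
    * by apply/measurable_EFinP; exact: measurable_tnth.
    * rewrite (_ : _ \o _ = cst 0%E); first exact: integrable0.
      by apply/funext => w /=; rewrite tnth_mktuple.
  + move=> i t; rewrite unlock (int_e (fun y => expR (t * tnth y i))).
    * by rewrite tnth_mktuple mulr0 lee_fin ler_expR divr_ge0 // mulr_ge0 // sqr_ge0.
    * apply: measurableT_comp => //; apply: measurable_funM => //.
      exact: measurable_tnth.
    * by move=> y; exact: expR_ge0.
move=> A B mA mB; have [h|h] := pselect (B zero_noise).
  rewrite (_ : e @^-1` B = setT); last by apply/seteqP; split.
  by rewrite setIT PT mule1.
rewrite (_ : e @^-1` B = set0); last by apply/seteqP; split.
by rewrite setI0 measure0 mule0.
Qed.

Lemma noiseless_risk (fhat : n.-tuple (cube d * R) -> cube d -> R) (f : cube d -> R) :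
  risk X e fhat f =
  (design_mean (fun x => sqnorm2 (fun y => fhat (sample f x zero_noise) y - f y)))%:E.
Proof.
rewrite /risk unlock integral_uniform_design // => x.
by apply: cube_mean_ge0 => y; exact: sqr_ge0.
Qed.

End NoiselessModel.

(** * The minimax lower bound and the conclusion *)

Lemma lower_bound (R : realType) (sigma K : R) (n d : nat) : (2 <= n)%N ->
  0 < K -> K <= Num.sqrt (ln (n%:R : R)) -> 8 * ln (n%:R : R) <= d%:R ->
  ((1152^-1 * (K ^+ 2 / (ln (n%:R : R) `^ (3 / 2))))%:E
     <= ereal_inf [set worst_case_risk sigma K fhat | fhat in estimator R d n])%E.
Proof.
move=> n2 K0 KL Ld; set L := ln n%:R in KL Ld *.
have ln2 : 2^-1 <= ln (2 : R).
  rewrite -[leLHS]expRK ler_ln ?posrE ?expR_gt0 //.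
  have h : 2^-1 <= expR (- 2^-1) :> R by have := expR_ge1Dx (- 2^-1 : R); lra.
  by rewrite -[2^-1]opprK expRN invf_ple ?posrE ?expR_gt0.
have L12 : 2^-1 <= L.
  by rewrite (le_trans ln2) // ler_ln ?posrE ?ltr0n ?ler_nat //; exact: ltn_trans n2.
have L0 : 0 < L by lra.
(* This gives [n < 2 ^ k], so [2 * k] variables, an even number with a true middle layer, provide
   [2 ^ (2 * k) >= 2 * n] head parts. From [ln 2 >= 1/2] and [L >= 1/2] follows
   [k <= 2 * L + 1 <= 4 * L]. *)
pose k := (trunc_log 2 n).+1.
have n0 : (0 < n)%N by exact: ltn_trans n2.
have /andP[kn nk] := trunc_log_bounds (isT : (1 < 2)%N) n0.
have kL : k%:R <= 4 * L.
  have : (trunc_log 2 n)%:R * ln (2 : R) <= L.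
    rewrite -ln_powR powR_mulrn // ler_ln ?posrE ?exprn_gt0 ?ltr0n //.
    by rewrite -natrX ler_nat.
  rewrite /k -natr1; have : 0 <= (trunc_log 2 n)%:R :> R by [].
  by nra.
have kd : (k.*2 <= d)%N.
  rewrite -(ler_nat R) (le_trans _ Ld) // -muln2 natrM; lra.
have k0 : 0 < k%:R :> R by rewrite ltr0n.
have nm : (2 * n <= 2 ^ k.*2)%N.
  rewrite -addnn expnD; apply: leq_mul; last exact: ltnW.
  by rewrite -[X in (X <= _)%N]expn1 leq_exp2l.
(* The largest height allowed by [2 * a * sqrt (2 * k) <= 6 * a * sqrt L <= K]. *)
pose a := K / (6 * Num.sqrt L).
have sL0 : 0 < Num.sqrt L by rewrite sqrtr_gt0.
have a0 : 0 <= a by rewrite divr_ge0 ?mulr_ge0 // ltW.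
have a1 : a <= 1 by rewrite /a ler_pdivrMr ?mulr_gt0 // mul1r; lra.
have sk : Num.sqrt k%:R <= 2 * Num.sqrt L.
  rewrite -ler_sqr ?nnegrE ?mulr_ge0 ?sqrtr_ge0 // exprMn !sqr_sqrtr ?(ltW L0) //.
  by rewrite (_ : 2 ^+ 2 = 4 :> R); [exact: kL|ring].
have s2k : Num.sqrt k.*2%:R <= 3 * Num.sqrt L.
  rewrite -ler_sqr ?nnegrE ?mulr_ge0 ?sqrtr_ge0 // exprMn !sqr_sqrtr ?(ltW L0) //.
  by rewrite -muln2 natrM (_ : 3 ^+ 2 = 9 :> R); [lra|ring].
apply: le_ereal_inf_tmp => _ [fhat mfhat <-].
pose z : n.-tuple R := [tuple 0 | _ < n].
pose rk theta := design_mean (fun X => sqnorm2 (fun x =>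
  fhat (sample (hard_fun k.*2 k a theta) X z) x - hard_fun k.*2 k a theta x)).
pose r := a ^+ 2 / 8 * ('C(k.*2, k)%:R / 2 ^+ k.*2).
(* Some labelling does at least as badly as the average one. *)
have [theta rtheta] : exists theta : {ffun cube d -> bool}, r <= rk theta.
  apply/not_existsP => H.
  have := average_risk k kd a fhat z nm; rewrite leNgt => /negP; apply.
  rewrite mulr_natl -sumr_const; apply: ltr_sum => [|theta _].
    by apply/hasP; exists [ffun _ => false] => //; rewrite mem_index_enum.
  by rewrite ltNge; apply/negP; exact: H.
have fK : monotone_class K (hard_fun k.*2 k a theta).
  split.
  - by move=> x; have /andP[-> /le_trans->] := hard_fun_bounds k.*2 k theta x a0.
  - exact: hard_fun_monotone.
  rewrite (le_trans (total_influence_junta (hard_fun_monotone _ _ _ a0)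
    (fun x => hard_fun_bounds k.*2 k theta x a0) (@hard_fun_irrelevant _ _ _ _ _ _))) //.
  rewrite card_head // /a.
  apply: (@le_trans _ _ (2 * (K / (6 * Num.sqrt L)) * (3 * Num.sqrt L))).
    by rewrite ler_wpM2l // mulr_ge0 // divr_ge0 ?mulr_ge0 // ltW.
  by rewrite (_ : _ * _ = K) //; field; rewrite gt_eqF.
apply: (@le_trans _ _ (rk theta)%:E); last first.
  apply: ereal_sup_ubound; do 6 eexists; split.
  - exact: noiseless_model.
  - exact: fK.
  - by rewrite noiseless_risk.
rewrite lee_fin; apply: le_trans rtheta.
have LE : L `^ (3 / 2) = L * Num.sqrt L.
  rewrite (_ : 3 / 2 = 1 + 2^-1); last by field.
  by rewrite powRD ?gt_eqF ?implybT // powRr1 ?powR12_sqrt // ltW.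
have s4 : 2 ^+ k.*2 = 4 ^+ k :> R.
  by rewrite -muln2 mulnC exprM; congr (_ ^+ k); ring.
have p4 : 0 < 4 ^+ k :> R by rewrite exprn_gt0.
have cb : (4 * Num.sqrt L)^-1 <= 'C(k.*2, k)%:R / 4 ^+ k.
  rewrite ler_pdivlMr // mulrC ler_pdivrMr ?mulr_gt0 //.
  apply: (le_trans (central_binomial_ge R (ltn0Sn _ : (0 < k)%N))).
  by rewrite mulrC ler_wpM2l //; lra.
rewrite LE /r s4.
(* The final constant is [1152 = 36 * 8 * 4]: from [a ^ 2], from the averaged error, and from the
   mass of the middle layer. *)
apply: (@le_trans _ _ (a ^+ 2 / 8 * (4 * Num.sqrt L)^-1)); last first.
  by rewrite ler_wpM2l // divr_ge0 // sqr_ge0.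
have sL2 : L = Num.sqrt L ^+ 2 by rewrite sqr_sqrtr // ltW.
rewrite /a {1}sL2; move: (Num.sqrt L) sL0 => s s0.
rewrite le_eqVlt; apply/orP; left; apply/eqP.
by field; rewrite gt_eqF.
Qed.

Theorem theorem2p1 (R : realType) (sigma : R) (hsigma : 0 < sigma)
    (eps : R) (heps0 : 0 < eps) (heps1 : eps < 1) :
  exists c C : R, 0 < c /\ 0 < C /\
  forall n d : nat, (2 <= n)%N -> (1 <= d)%N ->
    (ln (d%:R : R) <= n%:R `^ (1 - eps) ->
     exists fhat : n.-tuple (cube d * R) -> cube d -> R,
       estimator R d n fhat /\
       forall K : R, 1 <= K -> K <= d%:R ->
       forall (dO : measure_display) (Om : measurableType dO)
         (P : probability Om R) (X : {RV P >-> n.-tuple (cube d)})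
         (e : {RV P >-> n.-tuple R}),
         sampling_model sigma X e ->
         (ereal_sup [set risk X e fhat f | f in monotone_class K]
            <= (C * (K / Num.sqrt (ln (n%:R : R))))%:E)%E)
    /\
    (forall K : R, 0 < K -> K <= c * Num.sqrt (ln (n%:R : R)) ->
       c^-1 * ln (n%:R : R) <= d%:R ->
       ((c * (K ^+ 2 / (ln (n%:R : R) `^ (3 / 2))))%:E
          <= ereal_inf [set worst_case_risk sigma K fhat
                       | fhat in estimator R d n])%E).
Proof.
have [C C0 upper] := upper_bound sigma heps0 heps1.
have c1 : 1152^-1 <= 1 :> R by lra.
(* The constant of the risk bound also meets the two conditions of [lower_bound], as it is below
   both [1] and [1/8]. *)
exists 1152^-1, C; split; first by lra.
split => // n d n2 d1.
split => [hd|K K0 Kc].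
  have [fhat [mfhat rfhat]] := upper n d n2 d1 hd.
  by exists fhat; split => // K K1 _; exact: rfhat.
rewrite invrK => Ld.
have L0 : 0 <= ln (n%:R : R) by rewrite ln_ge0 // ler1n ltnW.
apply: lower_bound => //; last by lra.
by rewrite (le_trans Kc) // ler_piMl ?sqrtr_ge0.
Qed.
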